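(* Let $\imath,\jmath$ be probability measures on the metric spaces $(\mathbb{U},\rho_{\mathbb{U}})$, $(\mathbb{V},\rho_{\mathbb{V}})$ and let $J(u,dv)=\jmath(dv)$. Let $u\mapsto(m_u,\sigma_u)$ and $v\mapsto(n_v,\varsigma_v)$ be maps into $\mathbb{R}^d\times\mathcal{S}_d^+$, with estimates $u\mapsto(\widehat m_u,\widehat\sigma_u)$ and $v\mapsto(\widehat n_v,\widehat\varsigma_v)$. Let $\mathbb{B}_{u,v}$ be the exact Gaussian bridge transitions and, for $\epsilon>0$, $\widehat{\mathbb{B}}_{u,v}$ the $\epsilon$-inflated estimated Gaussian bridge transitions (see context), and set $$\mathbb{P}(d(u,x)):=\imath(du)\nu_{m_u,\sigma_u}(dx),\quad \mathbb{M}((u,x),d(v,y)):=\jmath(dv)\mathbb{B}_{u,v}(x,dy),$$ $$\widehat{\mathbb{P}}(d(u,x)):=\imath(du)\nu_{\widehat m_u,\widehat\sigma_u}(dx),\quad\widehat{\mathbb{M}}((u,x),d(v,y)):=\jmath(dv)\widehat{\mathbb{B}}_{u,v}(x,dy).$$ Assume: (i) there exists $a\ge0$ such that $\mathcal{D}_2\left(\mathbb{M}(x_d,\cdot),\mathbb{M}(\overline{x}_d,\cdot)\right)\le a\,\rho_{\mathbb{X}_d}(x_d,\overline{x}_d)$ for all $x_d,\overline{x}_d\in\mathbb{X}_d:=\mathbb{U}\times\mathbb{R}^d$; (ii) there exist $0<\underline{C}\le\overline{C}<\infty$ such that for $\imath$-almost every $u$ and $\jmath$-almost every $v$, $\lambda_{\min}(\sigma_u)\wedge\lambda_{\min}(\varsigma_v)\ge\underline{C}$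 and $\|\sigma_u\|_2\vee\|\varsigma_v\|_2\le\overline{C}$; (iii) $\chi\chi'\in\mathcal{S}_d^+$. Then there exists $C<\infty$ depending only on $(a,\underline{C},\overline{C},\chi)$ such that for any $\epsilon>0$ and $d\ge1$, $$\mathcal{D}_2\left(\widehat{\mathbb{P}}\times\widehat{\mathbb{M}},\mathbb{P}\times\mathbb{M}\right)^2\le Cd\left[\Delta_{m,2}+\Delta_{n,2}+\Delta_{\sigma,2}+\mathsf{B}\left(\Delta_{\varsigma,2}+\Delta_{\varsigma,4}^{1/2}+\epsilon^{-2}\left(\Delta_{\sigma,2}+\Delta_{\sigma,4}^{1/2}+\Delta_{\varsigma,4}^{1/2}\right)+\epsilon^2\right)\right],$$ where the quantities $\Delta_{\cdot,k}$ and $\mathsf{B}$ are defined in the context.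
   Context: $\mathcal{S}_d^+$ is the set of symmetric positive definite $d\times d$ real matrices; $\nu_{m,\sigma}$ is the Gaussian law on $\mathbb{R}^d$ with mean $m$ and covariance $\sigma$; $\|\cdot\|_2$ is the spectral norm (Euclidean norm for vectors), $\|\cdot\|_F$ the Frobenius norm, $\lambda_{\min}$ the smallest eigenvalue. The estimates $\widehat\sigma_u,\widehat\varsigma_v$ are symmetric positive semidefinite matrices, $\widehat m_u,\widehat n_v\in\mathbb{R}^d$. $\mathcal{D}_2$ is the $2$-Wasserstein distance $\mathcal{D}_2(\eta_1,\eta_2)=\inf\left(\int\rho(x_1,x_2)^2\,\pi(d(x_1,x_2))\right)^{1/2}$ over couplings $\pi$ of $\eta_1,\eta_2$, $\rho$ being the metric of the underlying space. On $\mathbb{X}_d=\mathbb{U}\times\mathbb{R}^d$ and $\mathbb{Y}_d=\mathbb{V}\times\mathbb{R}^d$ the metrics are $\rho_{\mathbb{X}_d}((u,x),(\overline u,\overline x))^2=\rho_{\mathbb{U}}(u,\overline u)^2+\|x-\overline x\|^2$, $\rho_{\mathbb{Y}_d}((v,y),(\overline v,\overline y))^2=\rho_{\mathbb{V}}(v,\overline v)^2+\|y-\overline y\|^2$ (Euclidean norms), and on $\mathbb{X}_d\times\mathbb{Y}_d$ the metric $\rho$ satisfies $\rho^2=\rho_{\mathbb{X}_d}^2+\rho_{\mathbb{Y}_d}^2$. For a probability measure $\mu$ and Markov kernel $K$, $(\mu\times K)(d(x,y)):=\mu(dx)K(x,dy)$. Gaussian bridges. Fix $\beta\in\mathbb{R}^{d\times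 d}$ and $\tau\in\mathcal{S}_d^+$, and set $\chi:=\tau^{-1}\beta$. For $\sigma,\varsigma$ let $\psi(\sigma,\varsigma):=\varsigma^{1/2}(\chi\sigma\chi')\varsigma^{1/2}$, $\omega(\sigma,\varsigma):=\psi(\sigma,\varsigma)^{-1}$, $\omega_\epsilon(\sigma,\varsigma):=(\psi(\sigma,\varsigma)+\epsilon I)^{-1}$; let $R(w):=\left(w+(w/2)^2\right)^{1/2}-w/2$ for $w\in\mathcal{S}_d^+$, and $\varphi(\sigma,\varsigma):=R(\omega(\sigma,\varsigma))$, $\varphi_\epsilon(\sigma,\varsigma):=R(\omega_\epsilon(\sigma,\varsigma))$. With $G$ standard Gaussian on $\mathbb{R}^d$, $\mathbb{B}_{u,v}(x,\cdot)$ is the law of $n_v+\kappa_{u,v}\chi(x-m_u)+\kappa_{u,v}^{1/2}G$ where $\kappa_{u,v}:=\varsigma_v^{1/2}\varphi(\sigma_u,\varsigma_v)\varsigma_v^{1/2}$, and $\widehat{\mathbb{B}}_{u,v}(x,\cdot)$ is the law of $\widehat n_v+\widehat\kappa_{u,v}\chi(x-\widehat m_u)+\widehat\kappa_{u,v}^{1/2}G$ where $\widehat\kappa_{u,v}:=\widehat\varsigma_v^{1/2}\varphi_\epsilon(\widehat\sigma_u,\widehat\varsigma_v)\widehat\varsigma_v^{1/2}$. Error quantities, for integers $k\ge1$: $\Delta_{m,k}:=\int\imath(du)\|\widehat m_u-m_u\|_2^k$, $\Delta_{\sigma,k}:=\int\imath(du)\|\widehat\sigma_u-\sigma_u\|_F^k$,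 $\Delta_{n,k}:=\int\jmath(dv)\|\widehat n_v-n_v\|_2^k$, $\Delta_{\varsigma,k}:=\int\jmath(dv)\|\widehat\varsigma_v-\varsigma_v\|_F^k$; $b_{\sigma,k}:=\int\imath(du)\|\widehat\sigma_u\|_2^k$, $b_{\varsigma,k}:=\int\jmath(dv)\|\widehat\varsigma_v\|_2^k$; and $$\mathsf{B}:=\max\left\{b_{\varsigma,1}^{1/2},\,b_{\varsigma,1},\,b_{\sigma,1}b_{\varsigma,2}^{1/2},\,b_{\sigma,1}b_{\varsigma,4}^{1/2},\,b_{\sigma,1},\,b_{\sigma,1}b_{\varsigma,1}^{1/2},\,b_{\varsigma,1}b_{\sigma,2}^{1/2},\,b_{\sigma,2}b_{\varsigma,2}^{1/2},\,b_{\sigma,2}b_{\varsigma,4}^{1/2},\,b_{\sigma,1}b_{\varsigma,1}\right\}.$$ *)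

(* Defs.v *)
From HB Require Import structures.
From mathcomp Require Import all_boot all_order all_algebra.
From mathcomp Require Import all_classical all_reals all_analysis.
From mathcomp Require Import measurable_realfun.

Set Implicit Arguments.
Unset Strict Implicit.
Unset Printing Implicit Defensive.

Import Order.TTheory GRing.Theory Num.Theory.
Import numFieldNormedType.Exports.

Local Open Scope classical_set_scope.
Local Open Scope ring_scope.

(* The library's measurable types are pointed, so a metric space carrying a
   probability measure (hence nonempty) comes with an arbitrary base point. *)
#[short(type="pmetricType")]
HB.structure Definition PointedMetric (K : numDomainType) :=
  { M of Metric K M & Pointed M }.

Section borel.
Variable T : ptopologicalType.

Definition borel : Type := T.

HB.instance Definition _ := Pointed.on borel.

Definition borel_sets : set (set borel) := <<s @open T >>.

Let borel0 : borel_sets set0.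
Proof. exact: sigma_algebra0. Qed.

Let borelC A : borel_sets A -> borel_sets (~` A).
Proof. by move=> bA; rewrite -setTD; exact: sigma_algebraCD. Qed.

Let borel_bigcup (F : (set borel)^nat) :
  (forall i, borel_sets (F i)) -> borel_sets (\bigcup_i F i).
Proof. exact: sigma_algebra_bigcup. Qed.

Definition borel_display : measure_display.
Proof. exact: sigma_display (@open T). Qed.

HB.instance Definition _ :=
  @isMeasurable.Build borel_display borel borel_sets borel0 borelC borel_bigcup.

End borel.

(* Matrices (and vectors) carry the sigma-algebra generated by the entries,
   i.e. the Borel sigma-algebra of R^(m x n). *)
Section measurable_matrix.
Context {R : realType} {m n : nat}.

Definition mx_sets : set (set 'M[R]_(m, n)) :=
  <<s \bigcup_(ij in [set: 'I_m * 'I_n]) preimage_set_system setT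
        (fun A : 'M[R]_(m, n) => A ij.1 ij.2) (@measurable _ (measurableTypeR R)) >>.

Let mx0 : mx_sets set0.
Proof. exact: sigma_algebra0. Qed.

Let mxC A : mx_sets A -> mx_sets (~` A).
Proof. by move=> bA; rewrite -setTD; exact: sigma_algebraCD. Qed.

Let mx_bigcup (F : (set 'M[R]_(m, n))^nat) :
  (forall i, mx_sets (F i)) -> mx_sets (\bigcup_i F i).
Proof. exact: sigma_algebra_bigcup. Qed.

Definition mx_display : measure_display.
Proof. exact: measure_tuple_display default_measure_display. Qed.

HB.instance Definition _ :=
  @isMeasurable.Build mx_display 'M[R]_(m, n) mx_sets mx0 mxC mx_bigcup.

Lemma measurable_entry i j :
  measurable_fun setT (fun A : 'M[R]_(m, n) => A i j).
Proof.
move=> _ B mB; apply: sub_sigma_algebra.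
by exists (i, j) => //; exists B.
Qed.

Lemma measurable_mx d (T : measurableType d) (f : T -> 'M[R]_(m, n)) :
  (forall i j, measurable_fun setT (fun t => f t i j)) -> measurable_fun setT f.
Proof.
move=> mf; apply: (@measurability _ _ _ _ setT f _ erefl) => _ [_ [ij _ [B mB <-]] <-].
by rewrite !setTI -comp_preimage -[X in measurable X]setTI; exact: mf.
Qed.

End measurable_matrix.

Section transport.
Local Open Scope ereal_scope.
Context {R : realType}.

Definition couplings d (T : measurableType d) (eta1 eta2 : set T -> \bar R) :
    set (probability (T * T)%type R) :=
  [set pi | forall A, measurable A ->
     pi (A `*` setT) = eta1 A /\ pi (setT `*` A) = eta2 A].

(* When [rho] is not measurable for the product sigma-algebra (which can only
   happen on nonseparable spaces), [\int] is the lower integral. *)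
Definition W2 d (T : measurableType d) (rho : T -> T -> R)
    (eta1 eta2 : set T -> \bar R) : \bar R :=
  ereal_inf [set (\int[pi]_z ((rho z.1 z.2) ^+ 2)%:E) `^ 2^-1
            | pi in couplings eta1 eta2].

(* The measure mu(dx) K(x, dy), as a function of sets, so that the
   measurability of [K] need not be proved beforehand; it is a probability
   measure whenever mu is one and K is a Markov kernel. *)
Definition kprod d d' (X : measurableType d) (Y : measurableType d')
    (mu : set X -> \bar R) (K : X -> set Y -> \bar R) : set (X * Y) -> \bar R :=
  fun A => \int[mu]_x K x (xsection A x).

Definition moment d (T : measurableType d) (mu : set T -> \bar R)
    (f : T -> R) (k : nat) : \bar R :=
  \int[mu]_x (f x ^+ k)%:E.

End transport.

Section linear_algebra.
Context {R : realType}.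

Definition enorm {n} (x : 'cV[R]_n) : R := Num.sqrt (\sum_i x i 0 ^+ 2).

Definition opnorm {m n} (A : 'M[R]_(m, n)) : R :=
  sup [set enorm (A *m x) | x in [set x : 'cV[R]_n | enorm x <= 1]].

Definition normF {m n} (A : 'M[R]_(m, n)) : R :=
  Num.sqrt (\sum_i \sum_j A i j ^+ 2).

Definition lambda_min {n} (A : 'M[R]_n) : R := inf [set a : R | eigenvalue A a].

Definition psd {n} (A : 'M[R]_n) : Prop :=
  A^T = A /\ forall x : 'cV[R]_n, 0 <= (x^T *m A *m x) 0 0.

Definition spd {n} (A : 'M[R]_n) : Prop :=
  A^T = A /\ forall x : 'cV[R]_n, x != 0 -> 0 < (x^T *m A *m x) 0 0.

(* The square root of a positive semidefinite [A] (and [0] if there is none). *)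
Definition sqrtm {n} (A : 'M[R]_n) : 'M[R]_n :=
  xget 0 [set B | psd B /\ B *m B = A].

End linear_algebra.

Section gaussian.
Context {R : realType}.

Definition cons_cV {n} (p : measurableTypeR R * 'cV[R]_n) : 'cV[R]_n.+1 :=
  col_mx (const_mx p.1 : 'M[R]_1) p.2.

Lemma measurable_cons_cV n : measurable_fun setT (@cons_cV n).
Proof.
apply: measurable_mx => i j; rewrite /cons_cV.
have [k|k] := split_ordP (i : 'I_(1 + n)) => ->.
  rewrite [X in measurable_fun _ X](_ : _ = fst); first exact: measurable_fst.
  apply/funext => p; transitivity ((const_mx p.1 : 'M[R]_1) k j).
    exact: (@col_mxEu R 1 n 1).
  by rewrite mxE.
rewrite [X in measurable_fun _ X](_ : _ = (fun x : 'cV[R]_n => x k j) \o snd).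
  exact: measurableT_comp (measurable_entry k j) measurable_snd.
by apply/funext => p; exact: (@col_mxEd R 1 n 1).
Qed.

HB.instance Definition _ n :=
  isMeasurableFun.Build _ _ _ _ (@cons_cV n) (@measurable_cons_cV n).

Section product_probability.
Context d d' (T : measurableType d) (T' : measurableType d').
Variables (P : probability T R) (Q : probability T' R).

Definition pprod : set (T * T') -> \bar R := (P \x Q)%E.

HB.instance Definition _ := Measure.on pprod.

Let pprod_setT : pprod setT = 1%E.
Proof.
rewrite /pprod -setXTT product_measure1E//.
transitivity (P setT * Q setT)%E => //.
by rewrite !probability_setT mule1.
Qed.

HB.instance Definition _ := Measure_isProbability.Build _ _ _ pprod pprod_setT.

End product_probability.

Fixpoint std_gauss n : probability 'cV[R]_n R :=
  match n with
  | 0 => \d_(0 : 'cV[R]_0)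
  | n'.+1 => distribution (pprod (normal_prob (0 : R) 1) (std_gauss n')) (@cons_cV n')
  end.

Definition affine {n} (m : 'cV[R]_n) (A : 'M[R]_n) (x : 'cV[R]_n) : 'cV[R]_n :=
  m + A *m x.

Lemma measurable_affine n (m : 'cV[R]_n) (A : 'M[R]_n) :
  measurable_fun setT (affine m A).
Proof.
apply: measurable_mx => i j; rewrite /affine.
rewrite [X in measurable_fun _ X](_ : _ = fun x : 'cV[R]_n =>
  m i j + \sum_(k <- index_enum 'I_n) A i k * x k j); last first.
  by apply/funext => x; rewrite !mxE.
apply: measurable_funD => //; apply: measurable_sum => k.
by apply: measurable_funM => //; exact: measurable_entry.
Qed.

HB.instance Definition _ n (m : 'cV[R]_n) (A : 'M[R]_n) :=
  isMeasurableFun.Build _ _ _ _ (affine m A) (measurable_affine m A).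

(* The law of m + s^{1/2} G. *)
Definition gauss {n} (m : 'cV[R]_n) (s : 'M[R]_n) : probability 'cV[R]_n R :=
  distribution (std_gauss n) (affine m (sqrtm s)).

End gaussian.

Section bridges.
Context {R : realType} {d : nat}.
Variable chi : 'M[R]_d.
Implicit Types (s vs w kap : 'M[R]_d) (m n x : 'cV[R]_d).

Definition psi s vs := sqrtm vs *m (chi *m s *m chi^T) *m sqrtm vs.

Definition omega s vs := invmx (psi s vs).

Definition omega_eps (eps : R) s vs := invmx (psi s vs + eps%:M).

Definition riccati w :=
  sqrtm (w + (2^-1 *: w) *m (2^-1 *: w)) - 2^-1 *: w.

Definition kappa s vs := sqrtm vs *m riccati (omega s vs) *m sqrtm vs.

Definition kappa_eps (eps : R) s vs :=
  sqrtm vs *m riccati (omega_eps eps s vs) *m sqrtm vs.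

(* The law of n + kap chi (x - m) + kap^{1/2} G. *)
Definition bridge m n kap x : probability 'cV[R]_d R :=
  gauss (n + kap *m chi *m (x - m)) kap.

End bridges.

Section models.
Context {R : realType} {d : nat} {U V : pmetricType R}.

Definition rho_aug {S : pmetricType R} (p q : borel S * 'cV[R]_d) : R :=
  Num.sqrt (mdist (p.1 : S) (q.1 : S) ^+ 2 + enorm (p.2 - q.2) ^+ 2).

Definition rho_joint (p q : (borel U * 'cV[R]_d) * (borel V * 'cV[R]_d)) : R :=
  Num.sqrt (rho_aug p.1 q.1 ^+ 2 + rho_aug p.2 q.2 ^+ 2).

Definition marginal (iota : probability (borel U) R)
    (m : borel U -> 'cV[R]_d) (s : borel U -> 'M[R]_d) :
    set (borel U * 'cV[R]_d) -> \bar R :=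
  kprod iota (fun u => gauss (m u) (s u)).

Definition transition (jota : probability (borel V) R) (chi : 'M[R]_d)
    (m : borel U -> 'cV[R]_d) (n : borel V -> 'cV[R]_d)
    (kap : borel U -> borel V -> 'M[R]_d) (p : borel U * 'cV[R]_d) :
    set (borel V * 'cV[R]_d) -> \bar R :=
  kprod jota (fun v => bridge chi (m p.1) (n v) (kap p.1 v) p.2).

End models.

Section bound.
Local Open Scope ereal_scope.
Context {R : realType}.

Definition Bmax (bs bv : nat -> \bar R) : \bar R :=
  \big[maxe/-oo]_(t <- [:: bv 1%N `^ 2^-1; bv 1%N; bs 1%N * bv 2%N `^ 2^-1;
    bs 1%N * bv 4%N `^ 2^-1; bs 1%N; bs 1%N * bv 1%N `^ 2^-1;
    bv 1%N * bs 2%N `^ 2^-1; bs 2%N * bv 2%N `^ 2^-1;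
    bs 2%N * bv 4%N `^ 2^-1; bs 1%N * bv 1%N]) t.

End bound.

(* Main.v *)
Require Import Defs.
From HB Require Import structures.
From mathcomp Require Import all_boot all_order all_algebra.
From mathcomp Require Import all_classical all_reals all_analysis.
From mathcomp Require Import measurable_realfun ring lra.

(** The bound follows from one explicit coupling. Let the two models share the
    points [u], [v] and both Gaussian noises [G1], [G2]. Writing hats for the
    estimates, the differences of the two outputs are

      (hat m - m) + T0 G1   and   (hat n - n) + T1 G1 + T2 G2,

    where T0, T1, T2 are the differences between estimated and exact values of
    sigma^(1/2), kappa chi sigma^(1/2) and kappa^(1/2). As |T G| <= |T| |G| and
    E|G|^2 is of order d, it remains to bound the spectral norms of the T's at
    given [u] and [v] ([integral_cost], [W2_le_cost]).

    The inverse in the definition of the bridge is only apparent: for positive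
    definite A, the Riccati map at A^-1 is 2 (1 + (1 + 4 A)^(1/2))^-1, called
    [gain A] ([riccatiE]). It solves r A r + r = 1 and is Lipschitz on all
    positive semidefinite matrices, since 1 + 4 A >= 1 and the square root is
    Lipschitz on matrices bounded below ([sqr_lipschitz], by testing on an
    extremal eigenvector of the difference). So kappa = varsigma^(1/2) (gain psi)
    varsigma^(1/2) depends on its data without any loss in 1 / eps, and
    inflating psi by eps costs eps. This yields two bounds on the squared
    norms of the T's:
    - [cost_crude]: at most a constant times
      ds^2 + 1 + |hat varsigma|, where ds is the error on sigma, because
      kappa <= 2 varsigma and kappa chi sigma chi' kappa <= varsigma;
    - [cost_fine]: at most a constant times ds^2 + dv^2 + eps^2, where dv is the
      error on varsigma. For dv <= 1 the estimate hat varsigma is bounded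
      and the Lipschitz bounds apply; for dv > 1 the crude bound is enough.

    The fine bound already has the announced form with 1 in place of the factor
    B, so it settles the case where B is at least Cl / 2 ([W2_le_fine]). When B
    is smaller, the mean norm of hat sigma is less than Cl / 2 while sigma >= Cl,
    so Ds 2 >= Cl^2 / 4; this absorbs the constants in the crude bound, whose
    last term is controlled by the mean norm of hat varsigma, itself less than
    Cl / 2 ([W2_le_crude], [small_estimate_Ds]).

    Two measurability questions come up. The matrix square root is measurable
    because it is a limit of polynomials in the entries ([cvg_sqrtm]), which also
    proves its existence. The metric and the spectral norm are integrated as
    lower integrals, which only requires monotonicity and the comparison
    [integral_le_add_lower]. *)

Set Implicit Arguments.
Unset Strict Implicit.
Unset Printing Implicit Defensive.

Import Order.TTheory GRing.Theory Num.Theory.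
Import numFieldNormedType.Exports.

Local Open Scope classical_set_scope.
Local Open Scope ring_scope.

(** * Euclidean vectors and bounds on spectral norms *)

Section euclidean.
Context {R : realType}.

Definition dot {n} (x y : 'cV[R]_n) : R := (x^T *m y) 0 0.

Section dot.
Context {n : nat}.
Implicit Types (x y z : 'cV[R]_n) (a c : R).

Lemma dotE x y : dot x y = \sum_i x i 0 * y i 0.
Proof. by rewrite /dot mxE; apply: eq_bigr => i _; rewrite mxE. Qed.

Lemma dotC x y : dot x y = dot y x.
Proof. by rewrite !dotE; apply: eq_bigr => i _; rewrite mulrC. Qed.

Lemma dotDr x y z : dot x (y + z) = dot x y + dot x z.
Proof. by rewrite /dot mulmxDr mxE. Qed.

Lemma dotZr a x y : dot x (a *: y) = a * dot x y.
Proof. by rewrite /dot -scalemxAr mxE. Qed.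

Lemma dotNr x y : dot x (- y) = - dot x y.
Proof. by rewrite /dot mulmxN mxE. Qed.

Lemma dotDl x y z : dot (x + y) z = dot x z + dot y z.
Proof. by rewrite dotC dotDr !(dotC z). Qed.

Lemma dotZl a x y : dot (a *: x) y = a * dot x y.
Proof. by rewrite dotC dotZr dotC. Qed.

Lemma dotNl x y : dot (- x) y = - dot x y.
Proof. by rewrite dotC dotNr dotC. Qed.

Definition dot_lin := (dotDr, dotDl, dotZr, dotZl, dotNr, dotNl).

Lemma dot_ge0 x : 0 <= dot x x.
Proof. by rewrite dotE sumr_ge0// => i _; rewrite -expr2 sqr_ge0. Qed.

Lemma dot_eq0 x : dot x x = 0 -> x = 0.
Proof.
rewrite dotE => /eqP; rewrite psumr_eq0 => [/allP x0|i _]; last first.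
  by rewrite -expr2 sqr_ge0.
apply/colP => i; rewrite mxE; apply/eqP.
by have := x0 i (mem_index_enum i); rewrite mulf_eq0 orbb.
Qed.

Lemma dot_gt0 x : x != 0 -> 0 < dot x x.
Proof.
move=> x0; rewrite lt0r dot_ge0 andbT; apply: contra x0 => /eqP/dot_eq0 ->.
exact: eqxx.
Qed.

Lemma enorm_ge0 x : 0 <= enorm x.
Proof. exact: sqrtr_ge0. Qed.

Lemma enormE x : enorm x = Num.sqrt (dot x x).
Proof. by rewrite /enorm dotE; under eq_bigr do rewrite expr2. Qed.

Lemma sqr_enorm x : enorm x ^+ 2 = dot x x.
Proof. by rewrite enormE sqr_sqrtr// dot_ge0. Qed.

Lemma enorm0 : enorm (0 : 'cV[R]_n) = 0.
Proof. by rewrite enormE /dot mulmx0 mxE sqrtr0. Qed.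

Lemma enormZ a x : enorm (a *: x) = `|a| * enorm x.
Proof.
by rewrite !enormE dotZl dotZr mulrA -expr2 sqrtrM ?sqr_ge0// sqrtr_sqr.
Qed.

Lemma enormN x : enorm (- x) = enorm x.
Proof. by rewrite -scaleN1r enormZ normrN1 mul1r. Qed.

Lemma enorm_le x c : 0 <= c -> dot x x <= c ^+ 2 -> enorm x <= c.
Proof.
by move=> c0 xc; rewrite -(ger0_norm c0) -sqrtr_sqr enormE ler_wsqrtr.
Qed.

End dot.

Lemma dot_trmx m n (A : 'M[R]_(m, n)) x y : dot (A *m x) y = dot x (A^T *m y).
Proof. by rewrite /dot trmx_mul mulmxA. Qed.

Lemma dot_symm n (A : 'M[R]_n) x y : A^T = A -> dot (A *m x) y = dot x (A *m y).
Proof. by move=> sA; rewrite dot_trmx sA. Qed.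

Lemma psdP n (A : 'M[R]_n) :
  psd A <-> A^T = A /\ forall x, 0 <= dot x (A *m x).
Proof. by split=> -[sA pA]; split=> // x; rewrite /dot ?mulmxA// -mulmxA; exact: pA. Qed.

Lemma psd_sym n (A : 'M[R]_n) : psd A -> A^T = A.
Proof. by case. Qed.

Lemma psd_ge0 n (A : 'M[R]_n) x : psd A -> 0 <= dot x (A *m x).
Proof. by move/psdP => [_]; apply. Qed.

(** Evaluate the quadratic form at [c x - b y], where [b] is the mixed term and
    [c] the form at [y]. When [c = 0], a large multiple of [y] forces [b = 0]. *)
Lemma psd_cauchy_schwarz n (A : 'M[R]_n) x y : psd A ->
  dot x (A *m y) ^+ 2 <= dot x (A *m x) * dot y (A *m y).
Proof.
move=> pA; have sA := psd_sym pA.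
have yx : dot y (A *m x) = dot x (A *m y) by rewrite -dot_symm// dotC.
set a := dot x (A *m x); set b := dot x (A *m y); set c := dot y (A *m y).
have key s t : 0 <= s ^+ 2 * a - 2 * s * t * b + t ^+ 2 * c.
  have := psd_ge0 (s *: x - t *: y) pA.
  rewrite mulmxBr -!scalemxAr !dot_lin yx -/a -/b -/c.
  by move=> h; lra.
have [c0|c0] : c = 0 \/ 0 < c.
  by have := psd_ge0 y pA; rewrite -/c le0r => /orP[/eqP|]; [left|right].
- have [->|b0] := eqVneq b 0; first by rewrite c0 expr0n/= mulr0.
  have := key 1 ((a + 1) / (2 * b)); rewrite c0.
  have -> : 2 * 1 * ((a + 1) / (2 * b)) * b = a + 1 by field.
  by rewrite expr1n mul1r mulr0 addr0 opprD addrA subrr add0r oppr_ge0 ler10.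
- have h : 0 <= c * (a * c - b ^+ 2) by have := key c b; lra.
  by move: h; rewrite pmulr_rge0// subr_ge0.
Qed.

Lemma psd1 n : psd (1%:M : 'M[R]_n).
Proof. by apply/psdP; split=> [|x]; rewrite ?trmx1// mul1mx dot_ge0. Qed.

Lemma dot_le_enorm n (x y : 'cV[R]_n) : dot x y <= enorm x * enorm y.
Proof.
have := psd_cauchy_schwarz x y (psd1 n); rewrite !mul1mx => xy.
apply: (le_trans (ler_norm _)).
by rewrite -sqrtr_sqr !enormE -sqrtrM ?dot_ge0// ler_wsqrtr.
Qed.

Lemma enormD n (x y : 'cV[R]_n) : enorm (x + y) <= enorm x + enorm y.
Proof.
apply: enorm_le; first by rewrite addr_ge0 ?enorm_ge0.
rewrite !dot_lin (dotC y x) sqrrD !sqr_enorm.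
have := dot_le_enorm x y; lra.
Qed.

(** [opb A c] says that the spectral norm of [A] is at most [c]; this form
    composes without ever computing a supremum. *)
Definition opb {m n} (A : 'M[R]_(m, n)) (c : R) : Prop :=
  forall x, enorm (A *m x) <= c * enorm x.

Section opb.

Lemma opbW m n (A : 'M[R]_(m, n)) a b : a <= b -> opb A a -> opb A b.
Proof.
by move=> ab Aa x; apply: (le_trans (Aa x)); rewrite ler_wpM2r ?enorm_ge0.
Qed.

Lemma opb0 m n a : 0 <= a -> opb (0 : 'M[R]_(m, n)) a.
Proof. by move=> a0 x; rewrite mul0mx enorm0 mulr_ge0 ?enorm_ge0. Qed.

Lemma opb1 n : opb (1%:M : 'M[R]_n) 1.
Proof. by move=> x; rewrite mul1mx mul1r. Qed.

Lemma opbD m n (A B : 'M[R]_(m, n)) a b :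
  opb A a -> opb B b -> opb (A + B) (a + b).
Proof.
by move=> Aa Bb x; rewrite mulmxDl mulrDl (le_trans (enormD _ _))// lerD.
Qed.

Lemma opbZ m n (A : 'M[R]_(m, n)) a c : opb A a -> opb (c *: A) (`|c| * a).
Proof.
by move=> Aa x; rewrite -scalemxAl enormZ -mulrA ler_wpM2l.
Qed.

Lemma opbN m n (A : 'M[R]_(m, n)) a : opb A a -> opb (- A) a.
Proof. by move=> Aa x; rewrite mulNmx enormN. Qed.

Lemma opbB m n (A B : 'M[R]_(m, n)) a b :
  opb A a -> opb B b -> opb (A - B) (a + b).
Proof. by move=> Aa /opbN; exact: opbD. Qed.

Lemma opbM m n p (A : 'M[R]_(m, n)) (B : 'M[R]_(n, p)) a b :
  0 <= a -> opb A a -> opb B b -> opb (A *m B) (a * b).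
Proof.
move=> a0 Aa Bb x; rewrite -mulmxA (le_trans (Aa _))// -mulrA.
by rewrite ler_wpM2l.
Qed.

(** [|A^T x|^2 = <x, A A^T x> <= a |x| |A^T x|]. *)
Lemma opb_tr m n (A : 'M[R]_(m, n)) a : 0 <= a -> opb A a -> opb A^T a.
Proof.
move=> a0 Aa x; have [->|Ax0] := eqVneq (A^T *m x) 0.
  by rewrite enorm0 mulr_ge0 ?enorm_ge0.
have Ax : 0 < enorm (A^T *m x) by rewrite enormE sqrtr_gt0 dot_gt0.
rewrite -(ler_pM2r Ax) -expr2 sqr_enorm dot_trmx trmxK.
apply: (le_trans (dot_le_enorm _ _)).
by rewrite mulrAC mulrC ler_wpM2r ?enorm_ge0.
Qed.

Lemma opb_qf n (A : 'M[R]_n) a x : opb A a -> dot x (A *m x) <= a * dot x x.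
Proof.
move=> Aa; apply: (le_trans (dot_le_enorm _ _)).
by rewrite -sqr_enorm expr2 mulrCA ler_wpM2l ?enorm_ge0.
Qed.

Lemma normF_ge0 m n (A : 'M[R]_(m, n)) : 0 <= normF A.
Proof. exact: sqrtr_ge0. Qed.

Lemma sqr_normF m n (A : 'M[R]_(m, n)) :
  normF A ^+ 2 = \sum_i \sum_j A i j ^+ 2.
Proof.
by rewrite sqr_sqrtr//; apply: sumr_ge0 => i _; apply: sumr_ge0 => j _; exact: sqr_ge0.
Qed.

(** Cauchy-Schwarz on each row. *)
Lemma opb_normF m n (A : 'M[R]_(m, n)) : opb A (normF A).
Proof.
move=> x; apply: enorm_le; first by rewrite mulr_ge0 ?enorm_ge0 ?normF_ge0.
rewrite exprMn sqr_enorm sqr_normF dotE mulr_suml; apply: ler_sum => i _.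
pose r : 'cV[R]_n := (row i A)^T.
have -> : (A *m x) i 0 = dot r x.
  by rewrite dotE mxE; apply: eq_bigr => j _; rewrite !mxE.
have -> : \sum_j A i j ^+ 2 = dot r r.
  by rewrite dotE; apply: eq_bigr => j _; rewrite !mxE expr2.
by have := psd_cauchy_schwarz r x (psd1 n); rewrite !mul1mx expr2.
Qed.

Let opnorm_ub m n (A : 'M[R]_(m, n)) x :
  enorm x <= 1 -> enorm (A *m x) <= opnorm A.
Proof.
move=> x1; apply: ub_le_sup; last by exists x.
exists (normF A) => _ [z /= z1 <-]; apply: (le_trans (opb_normF A z)).
by rewrite ler_piMr ?normF_ge0.
Qed.

Lemma opb_opnorm m n (A : 'M[R]_(m, n)) : opb A (opnorm A).
Proof.
move=> x; have [->|x0] := eqVneq x 0.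
  by rewrite mulmx0 !enorm0 mulr0.
have nx : 0 < enorm x by rewrite enormE sqrtr_gt0 dot_gt0.
have : enorm (A *m ((enorm x)^-1 *: x)) <= opnorm A.
  apply: opnorm_ub.
  by rewrite enormZ gtr0_norm ?invr_gt0// mulVf// gt_eqF.
rewrite -scalemxAr enormZ gtr0_norm ?invr_gt0//.
by rewrite mulrC ler_pdivrMr.
Qed.

Lemma opnorm_ge0 m n (A : 'M[R]_(m, n)) : 0 <= opnorm A.
Proof.
by apply: (le_trans (enorm_ge0 _) (@opnorm_ub _ _ A 0 _)); rewrite enorm0.
Qed.

End opb.
End euclidean.

(** * Extremal eigenvectors of symmetric matrices *)

Section spectral.
Context {R : realType}.

(** The Loewner inequality [c I <= A]. *)
Definition lowb {n} (A : 'M[R]_n) (c : R) : Prop :=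
  forall x, c * dot x x <= dot x (A *m x).

Lemma opb_sqr m n (A : 'M[R]_(m, n)) a : 0 <= a ->
  (forall x, dot (A *m x) (A *m x) <= a ^+ 2 * dot x x) -> opb A a.
Proof.
move=> a0 Aa x; apply: enorm_le; first by rewrite mulr_ge0 ?enorm_ge0.
by rewrite exprMn sqr_enorm.
Qed.

(** With [y = A^-1 x], Cauchy-Schwarz for the form of [A] gives
    [|x|^4 <= <x, A x> <y, x>], and [<y, x>] is at most a multiple of [|x|^2]. *)
Lemma psd_unit_lowb n (A : 'M[R]_n) : psd A -> A \in unitmx ->
  exists2 c, 0 < c & lowb A c.
Proof.
move=> pA uA; have sA := psd_sym pA.
pose K := normF (invmx A) + 1.
have K0 : 0 < K by rewrite ltr_wpDl ?normF_ge0.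
have iK : opb (invmx A) K by apply: opbW (opb_normF _); rewrite lerDl.
exists K^-1; first by rewrite invr_gt0.
move=> x; pose y := invmx A *m x; have xE : A *m y = x by rewrite mulKVmx.
have [->|x0] := eqVneq x 0; first by rewrite mulmx0 /dot mulmx0 mxE mulr0.
have := psd_cauchy_schwarz x y pA; rewrite xE => h.
have h2 : dot y x <= K * dot x x by rewrite dotC; exact: opb_qf.
have h3 : dot x x ^+ 2 <= dot x (A *m x) * (K * dot x x).
  by apply: (le_trans h); rewrite ler_wpM2l// psd_ge0.
move: h3; rewrite expr2 mulrA ler_pM2r ?dot_gt0// => h3.
by rewrite mulrC ler_pdivrMr.
Qed.

(** The infimum [mu] of the Rayleigh quotient is an eigenvalue: otherwise
    [S - mu] would be positive semidefinite and invertible, hence bounded below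
    by a positive constant, and [mu] could be increased. *)
Lemma min_eigenvector n (S : 'M[R]_n) : (0 < n)%N -> S^T = S ->
  exists (mu : R) (y : 'cV[R]_n), [/\ y != 0, S *m y = mu *: y & lowb S mu].
Proof.
case: n S => // n S _ sS.
pose E := [set r : R | lowb S r].
pose e : 'cV[R]_n.+1 := delta_mx 0 0.
have e1 : dot e e = 1.
  rewrite dotE (bigD1 0)//= big1 => [|i i0]; first by rewrite mxE !eqxx mulr1 addr0.
  by rewrite mxE (negbTE i0) mul0r.
have E0 : E !=set0.
  exists (- normF S) => x; rewrite mulNr lerNl -dotNr -mulNmx.
  by apply: opb_qf; apply: opbN; exact: opb_normF.
have Eub : has_ubound E.
  by exists (dot e (S *m e)) => r /(_ e); rewrite e1 mulr1.
pose mu := sup E.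
have Emu : lowb S mu.
  move=> x; have [->|x0] := eqVneq x 0; first by rewrite mulmx0 /dot mulmx0 mxE mulr0.
  rewrite -ler_pdivlMr ?dot_gt0//; apply: ge_sup => // r /(_ x).
  by rewrite ler_pdivlMr ?dot_gt0.
pose M := S - mu%:M.
have ME x : dot x (M *m x) = dot x (S *m x) - mu * dot x x.
  by rewrite mulmxBl mul_scalar_mx !dot_lin.
have sM : M^T = M by rewrite /M linearB/= tr_scalar_mx sS.
have pM : psd M by apply/psdP; split => // x; rewrite ME subr_ge0.
have /det0P[v v0 vM] : \det M == 0.
  apply/negP => /negP dM; have uM : M \in unitmx by rewrite unitmxE unitfE.
  have [c c0 Mc] := psd_unit_lowb pM uM.
  have : mu + c <= mu.
    apply: ub_le_sup => // x; have := Mc x; rewrite ME; lra.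
  by rewrite gerDl leNgt c0.
exists mu, v^T; split => //.
- by apply: contra v0 => /eqP v0; rewrite -[v]trmxK v0 trmx0.
- apply/eqP; rewrite -subr_eq0 -mul_scalar_mx -mulmxBl -/M -sM -trmx_mul vM.
  by rewrite trmx0.
Qed.

Lemma lowbW n (A : 'M[R]_n) a b : a <= b -> lowb A b -> lowb A a.
Proof.
by move=> ab Ab x; apply: le_trans (Ab x); rewrite ler_wpM2r ?dot_ge0.
Qed.

Lemma lowb_le_opb n (A : 'M[R]_n) a b : (0 < n)%N -> lowb A a -> opb A b -> a <= b.
Proof.
move=> n0 Aa Ab; pose e : 'cV[R]_n := const_mx 1.
have e0 : e != 0.
  by apply/eqP => /colP/(_ (Ordinal n0))/eqP; rewrite !mxE oner_eq0.
by have := le_trans (Aa e) (opb_qf e Ab); rewrite ler_pM2r// dot_gt0.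
Qed.

Lemma lowb_lambda_min n (A : 'M[R]_n) : (0 < n)%N -> psd A ->
  lowb A (lambda_min A).
Proof.
move=> n0 pA; have [mu [y [y0 yE Amu]]] := min_eigenvector n0 (psd_sym pA).
apply: lowbW Amu; apply: ge_inf; last first.
  apply/eigenvalueP; exists y^T; last first.
    by apply: contra y0 => /eqP y0; rewrite -[y]trmxK y0 trmx0.
  by rewrite -{1}(psd_sym pA) -trmx_mul yE linearZ.
exists 0 => a /eigenvalueP[v va v0].
have w0 : v^T != 0 by apply: contra v0 => /eqP h; rewrite -[v]trmxK h trmx0.
have : 0 <= dot v^T (A *m v^T) by exact: psd_ge0.
by rewrite -{1}(psd_sym pA) -trmx_mul va linearZ/= dotZr pmulr_lge0 ?dot_gt0.
Qed.

(** A lowest eigenvector [y] of [- S^2] satisfies [(S - L) (S + L) y = 0] with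
    [L] the spectral norm of [S], so either [y] or [(S + L) y] is an eigenvector
    of [S] for [L] or [- L]. *)
Lemma max_eigenvector n (S : 'M[R]_n) : (0 < n)%N -> S^T = S ->
  exists (mu : R) (y : 'cV[R]_n), [/\ y != 0, S *m y = mu *: y & opb S `|mu|].
Proof.
move=> n0 sS.
have sX : (- (S *m S))^T = - (S *m S) by rewrite linearN/= trmx_mul sS.
have [nu [y [y0 yE Snu]]] := min_eigenvector n0 sX.
have SE : dot (S *m y) (S *m y) = - nu * dot y y.
  by rewrite dot_symm// mulmxA -[S *m S]opprK mulNmx yE dotNr dotZr mulNr.
have nu0 : nu <= 0.
  have := dot_ge0 (S *m y).
  by rewrite SE pmulr_lge0 ?dot_gt0// oppr_ge0.
pose L := Num.sqrt (- nu).
have L2 : L ^+ 2 = - nu by rewrite sqr_sqrtr// oppr_ge0.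
have SL : opb S L.
  apply: opb_sqr => [|x]; first exact: sqrtr_ge0.
  by rewrite L2 dot_symm// mulmxA mulNr lerNr -dotNr -mulNmx.
have SSy : S *m (S *m y) = (L ^+ 2) *: y.
  by rewrite L2 mulmxA -[S *m S]opprK mulNmx yE scaleNr.
have [z0|z0] := eqVneq (S *m y + L *: y) 0.
- exists (- L), y; split => //; last by rewrite normrN ger0_norm// sqrtr_ge0.
  by apply/eqP; rewrite scaleNr -addr_eq0; apply/eqP.
- exists L, (S *m y + L *: y); split => //.
    by rewrite mulmxDr SSy -scalemxAr scalerDr scalerA -expr2 addrC.
  by rewrite ger0_norm// sqrtr_ge0.
Qed.

(** Testing [S^2 - T^2 = S (S - T) + (S - T) T] on an extremal eigenvector of
    [S - T]. *)
Lemma sqr_lipschitz n (S T : 'M[R]_n) c eta : (0 < n)%N ->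
  psd S -> T^T = T -> 0 < c -> lowb T c -> opb (S *m S - T *m T) eta ->
  opb (S - T) (eta / c).
Proof.
move=> n0 pS sT c0 Tc STe; have sS := psd_sym pS.
have sX : (S - T)^T = S - T by rewrite linearB/= sS sT.
have [mu [y [y0 yE Xmu]]] := max_eigenvector n0 sX.
apply: opbW Xmu; rewrite ler_pdivlMr// -(ler_pM2r (dot_gt0 y0)).
have E : dot y ((S *m S - T *m T) *m y)
    = mu * (dot y (S *m y) + dot y (T *m y)).
  rewrite (_ : S *m S - T *m T = S *m (S - T) + (S - T) *m T); last first.
    by rewrite mulmxBr mulmxBl addrA subrK.
  rewrite mulmxDl dotDr -!mulmxA yE -(dot_symm _ _ sX) yE -scalemxAr.
  by rewrite dotZr dotZl -mulrDr.
have e1 : `|mu * (dot y (S *m y) + dot y (T *m y))| <= eta * dot y y.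
  rewrite -E ler_norml; apply/andP; split; last exact: opb_qf.
  by rewrite lerNl -dotNr -mulNmx; apply: opb_qf; exact: opbN.
apply: le_trans e1; rewrite normrM -mulrA ler_wpM2l// ger0_norm.
  by rewrite ler_wpDl ?psd_ge0.
apply: addr_ge0; first exact: psd_ge0.
by apply: le_trans (Tc y); rewrite mulr_ge0 ?dot_ge0 ?ltW.
Qed.

(** Compare both sides on a lowest eigenvector of [S]. *)
Lemma psd_sqr_lowb n (S : 'M[R]_n) c : (0 < n)%N -> psd S -> 0 <= c ->
  lowb (S *m S) (c ^+ 2) -> lowb S c.
Proof.
move=> n0 pS c0 Sc; have [mu [y [y0 yE Smu]]] := min_eigenvector n0 (psd_sym pS).
have mu0 : 0 <= mu.
  by have := psd_ge0 y pS; rewrite yE dotZr pmulr_lge0 ?dot_gt0.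
apply: lowbW Smu; have := Sc y.
rewrite -mulmxA yE -scalemxAr yE scalerA dotZr ler_pM2r ?dot_gt0// -expr2.
by rewrite ler_pXn2r.
Qed.

(** With [X = S - T], the identity [X S + T X = S^2 - T^2 = 0] shows that
    [X S X] and [X T X] have opposite traces; both are positive semidefinite, so
    [S] and [T] vanish on the range of [X], and hence so does [X]. *)
Lemma psd_sqrt_uniq n (S T : 'M[R]_n) : psd S -> psd T ->
  S *m S = T *m T -> S = T.
Proof.
move=> pS pT ST; have [sS sT] := (psd_sym pS, psd_sym pT).
pose X := S - T; have sX : X^T = X by rewrite linearB/= sS sT.
have XST : X *m S + T *m X = 0.
  by rewrite mulmxBl mulmxBr ST addrA subrK subrr.
have psd_ker (A : 'M[R]_n) z : psd A -> dot z (A *m z) = 0 -> A *m z = 0.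
  move=> pA Az; apply: dot_eq0.
  have := psd_cauchy_schwarz (A *m z) z pA; rewrite Az mulr0 => h.
  by apply/eqP; rewrite -sqrf_eq0 eq_le h sqr_ge0.
have qfE (A : 'M[R]_n) i : dot (col i X) (A *m col i X) = (X *m (A *m X)) i i.
  rewrite colE dot_trmx sX dotE (bigD1 i)//= big1 => [|j ij].
    by rewrite mxE !eqxx mul1r addr0 !mulmxA -colE mxE.
  by rewrite mxE (negbTE ij) mul0r.
have tr0 : \sum_i (dot (col i X) (S *m col i X) + dot (col i X) (T *m col i X)) = 0.
  rewrite big_split/=.
  under eq_bigr do rewrite qfE.
  under [X in _ + X]eq_bigr do rewrite qfE.
  rewrite -!/(\tr _) mulmxA mxtrace_mulC -raddfD/= -mulmxDr XST mulmx0.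
  exact: mxtrace0.
have X0 i : S *m col i X = 0 /\ T *m col i X = 0.
  move/eqP: tr0; rewrite psumr_eq0 => [|j _]; last by rewrite addr_ge0 ?psd_ge0.
  move=> /allP/(_ i (mem_index_enum _)).
  rewrite paddr_eq0 ?psd_ge0// => /andP[/eqP h1 /eqP h2].
  by split; apply: psd_ker.
apply/eqP; rewrite -subr_eq0 -/X; apply/eqP/matrixP => i j.
have [Sj Tj] := X0 j.
have : col j X = 0.
  apply: dot_eq0.
  have -> : dot (col j X) (col j X) = (X *m X) j j.
    by rewrite -[X in dot _ X]mul1mx qfE mul1mx.
  rewrite (_ : (X *m X) j j = (X *m col j X) j 0); last first.
    by rewrite [in RHS]colE mulmxA -colE [RHS]mxE.
  by rewrite mulmxBl Sj Tj subrr mxE.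
by move=> /colP/(_ i); rewrite !mxE.
Qed.

Lemma spd_psd n (A : 'M[R]_n) : spd A -> psd A.
Proof.
move=> [sA pA]; split=> // x; have [->|x0] := eqVneq x 0.
  by rewrite mulmx0 mxE.
exact/ltW/pA.
Qed.

Lemma spd_unit n (A : 'M[R]_n) : spd A -> A \in unitmx.
Proof.
move=> [sA pA]; rewrite unitmxE unitfE; apply/det0P => -[v v0 vA].
have : v^T != 0 by apply: contra v0 => /eqP h; rewrite -[v]trmxK h trmx0.
by move=> /pA; rewrite trmxK vA mul0mx mxE ltxx.
Qed.

Lemma lowb_spd n (A : 'M[R]_n) c : A^T = A -> 0 < c -> lowb A c -> spd A.
Proof.
move=> sA c0 Ac; split=> // x x0; rewrite -mulmxA.
by apply: lt_le_trans (Ac x); rewrite mulr_gt0// dot_gt0.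
Qed.

(** Cauchy-Schwarz for the form of [A], at [A x] and [x]. *)
Lemma opb_psd_sqr n (A : 'M[R]_n) a x : psd A -> opb A a ->
  dot (A *m x) (A *m x) <= a * dot x (A *m x).
Proof.
move=> pA Aa; have [->|z0] := eqVneq (A *m x) 0.
  by rewrite /dot mulmx0 mulmx0 mxE mulr0.
have h := psd_cauchy_schwarz (A *m x) x pA.
have h2 : dot (A *m x) (A *m x) ^+ 2 <= a * dot (A *m x) (A *m x) * dot x (A *m x).
  by apply: (le_trans h); rewrite ler_wpM2r ?psd_ge0// opb_qf.
by move: h2; rewrite expr2 mulrAC ler_pM2r ?dot_gt0.
Qed.

Lemma trmx_invmx_sym n (A : 'M[R]_n) : A^T = A -> (invmx A)^T = invmx A.
Proof. by move=> sA; rewrite trmx_inv sA. Qed.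

Lemma invmx_lowb n (A : 'M[R]_n) a : psd A -> A \in unitmx -> 0 < a ->
  opb A a -> lowb (invmx A) a^-1.
Proof.
move=> pA uA a0 Aa x; rewrite mulrC ler_pdivrMr// mulrC.
rewrite -{1 2 3}(mulKVmx uA x); set y := invmx A *m x.
by rewrite (dotC (A *m y) y); exact: opb_psd_sqr.
Qed.

Lemma invmx_opb n (A : 'M[R]_n) c : 0 < c -> lowb A c -> A \in unitmx ->
  opb (invmx A) c^-1.
Proof.
move=> c0 Ac uA x; set y := invmx A *m x.
have [y0|y0] := eqVneq y 0.
  by rewrite y0 enorm0 mulr_ge0 ?enorm_ge0 ?invr_ge0 ?ltW.
have ny : 0 < enorm y by rewrite enormE sqrtr_gt0 dot_gt0.
rewrite mulrC ler_pdivlMr// -(ler_pM2r ny) mulrAC -expr2 sqr_enorm mulrC.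
apply: (le_trans (Ac y)); rewrite mulKVmx// mulrC; exact: dot_le_enorm.
Qed.

End spectral.

(** * The square root of a positive semidefinite matrix *)

Section square_root.
Context {R : realType} {n : nat}.
Implicit Types A B M N : 'M[R]_n.

Let cvg_sum (I : Type) (r : seq I) (f : I -> nat -> R) (l : I -> R) :
  (forall i, f i k @[k --> \oo] --> l i) ->
  \sum_(i <- r) f i k @[k --> \oo] --> \sum_(i <- r) l i.
Proof. by move=> fl; apply: cvg_big => [|i _]; [exact: add_continuous|exact: fl]. Qed.

Section iteration.
Variable B : 'M[R]_n.

Fixpoint mpow k : 'M[R]_n := if k is k'.+1 then B *m mpow k' else 1%:M.

(** Polynomials in [B] with nonnegative coefficients. They are positive
    semidefinite when [B] is, and closed under products, which is how
    monotonicity of the iteration below is obtained without diagonalizing. *)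
Inductive nnpoly : 'M[R]_n -> Prop :=
| nnpoly_pow k : nnpoly (mpow k)
| nnpolyD M N : nnpoly M -> nnpoly N -> nnpoly (M + N)
| nnpolyZ c M : 0 <= c -> nnpoly M -> nnpoly (c *: M).

Lemma mpowD i j : mpow (i + j) = mpow i *m mpow j.
Proof. by elim: i => [|i IH]; rewrite ?mul1mx// addSn/= IH mulmxA. Qed.

Lemma nnpolyM M N : nnpoly M -> nnpoly N -> nnpoly (M *m N).
Proof.
move=> pM; elim: pM N => [i N pN|M1 M2 _ IH1 _ IH2 N pN|c M1 c0 _ IH N pN].
- elim: pN => [j|N1 N2 _ IH1 _ IH2|c N1 c0 _ IH].
  + by rewrite -mpowD; exact: nnpoly_pow.
  + by rewrite mulmxDr; exact: nnpolyD.
  + by rewrite -scalemxAr; exact: nnpolyZ.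
- by rewrite mulmxDl; apply: nnpolyD; [exact: IH1|exact: IH2].
- by rewrite -scalemxAl; apply: nnpolyZ => //; exact: IH.
Qed.

(** Visser's iteration: for [0 <= B <= 1] it increases to the solution [Y] of
    [Y = (B + Y^2) / 2], that is of [(1 - Y)^2 = 1 - B]. *)
Fixpoint visser k : 'M[R]_n :=
  if k is k'.+1 then 2^-1 *: (B + visser k' *m visser k') else 0.

(** The increments satisfy [2 (Y'' - Y') = (Y' - Y) Y' + Y (Y' - Y)]. *)
Lemma nnpoly_visser k : nnpoly (visser k) /\ nnpoly (visser k.+1 - visser k).
Proof.
have pB : nnpoly B by have := nnpoly_pow 1; rewrite /= mulmx1.
have h0 : 0 <= 2^-1 :> R by rewrite invr_ge0.
elim: k => [|k [pk pd]].
  rewrite /= mul0mx addr0 subr0; split; last exact: nnpolyZ.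
  by have := nnpolyZ (lexx 0) (nnpoly_pow 0); rewrite scale0r.
have pk1 : nnpoly (visser k.+1).
  by apply: nnpolyZ => //; apply: nnpolyD => //; exact: nnpolyM.
split=> //.
set Y := visser k in pk pd *; set Z := visser k.+1 in pd pk1 *.
have -> : visser k.+2 - Z = 2^-1 *: ((Z - Y) *m Z + Y *m (Z - Y)).
  rewrite [visser _.+2]/(2^-1 *: (B + Z *m Z)) [X in _ - X]/(2^-1 *: (B + Y *m Y)).
  rewrite -scalerBr; congr (_ *: _).
  by rewrite mulmxBl mulmxBr addrA subrK opprD addrACA subrr add0r.
by apply: nnpolyZ => //; apply: nnpolyD; exact: nnpolyM.
Qed.

Hypothesis pB : psd B.

Lemma psd_nnpoly M : nnpoly M -> psd M.
Proof.
have sB := psd_sym pB.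
elim=> [k|M1 N1 _ pM _ pN|c M1 c0 _ pM]; apply/psdP.
- suff [] : psd (mpow k) /\ psd (mpow k.+1) by move=> /psdP.
  elim: k => [|k [IH1 IH2]]; first by split; [exact: psd1|rewrite /= mulmx1].
  split=> //; rewrite [mpow _.+2]/= (_ : B *m mpow k = mpow k *m B); last first.
    by rewrite -[LHS]/(mpow (1 + k)) addnC mpowD /= mulmx1.
  apply/psdP; split=> [|x]; first by rewrite !trmx_mul sB (psd_sym IH1) mulmxA.
  by rewrite -!mulmxA -dot_symm//; exact: psd_ge0.
- split=> [|x]; first by rewrite linearD/= (psd_sym pM) (psd_sym pN).
  by rewrite mulmxDl dotDr addr_ge0 ?psd_ge0.
- split=> [|x]; first by rewrite linearZ/= (psd_sym pM).
  by rewrite -scalemxAl dotZr mulr_ge0 ?psd_ge0.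
Qed.

Hypothesis B1 : opb B 1.

Lemma opb_visser k : opb (visser k) 1.
Proof.
elim: k => [|k IH] /=; first exact: opb0.
have := opbZ 2^-1 (opbD B1 (opbM ler01 IH IH)).
rewrite ger0_norm ?invr_ge0// mulr1 (_ : _ * _ = 1)//.
by rewrite (_ : 1 + 1 = 2 :> R)// mulVf.
Qed.

Lemma cvg_visser_qf x : cvgn (fun k => dot x (visser k *m x)).
Proof.
apply: nondecreasing_is_cvgn.
  apply/nondecreasing_seqP => k; rewrite -subr_ge0 -dotNr -dotDr -mulNmx -mulmxDl.
  apply: psd_ge0; apply: psd_nnpoly; exact: (nnpoly_visser k).2.
exists (dot x x) => _ [k _ <-]; rewrite -[leRHS]mul1r; apply: opb_qf.
exact: opb_visser.
Qed.

(** By polarization, from the convergence of the quadratic forms. *)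
Lemma cvg_visser i j : cvgn (fun k => visser k i j).
Proof.
pose e l : 'cV[R]_n := delta_mx l 0.
have eE M l l' : dot (e l) (M *m e l') = M l l'.
  rewrite dotE (bigD1 l)//= big1 => [|r rl]; last by rewrite mxE (negbTE rl) mul0r.
  by rewrite mxE !eqxx mul1r addr0 -colE mxE.
have -> : (fun k => visser k i j) = (fun k => 2^-1 *
    (dot (e i + e j) (visser k *m (e i + e j)) - dot (e i) (visser k *m e i)
     - dot (e j) (visser k *m e j))).
  apply/funext => k; rewrite mulmxDr !dot_lin !eE.
  have -> : visser k j i = visser k i j.
    by rewrite -{1}(psd_sym (psd_nnpoly (nnpoly_visser k).1)) mxE.
  by field.
apply: is_cvgMr; apply: is_cvgB; first apply: is_cvgB; exact: cvg_visser_qf.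
Qed.

Definition visser_lim : 'M[R]_n := \matrix_(i, j) limn (fun k => visser k i j).

Lemma visser_limP i j : visser k i j @[k --> \oo] --> visser_lim i j.
Proof. by rewrite mxE; exact: cvg_visser. Qed.

Lemma visser_lim_sqrt :
  psd (1%:M - visser_lim) /\
  (1%:M - visser_lim) *m (1%:M - visser_lim) = 1%:M - B.
Proof.
set L := visser_lim.
have fixL : L = 2^-1 *: (B + L *m L).
  apply/matrixP => i j.
  have h1 : visser k.+1 i j @[k --> \oo] --> L i j.
    by have := @visser_limP i j; rewrite -(cvg_shiftS (fun k => visser k i j)).
  have h2 : visser k.+1 i j @[k --> \oo] --> (2^-1 *: (B + L *m L)) i j.
    rewrite /= [X in _ --> X](_ : _ = 2^-1 * (B i j + \sum_l L i l * L l j)); last first.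
      by rewrite !mxE.
    rewrite (_ : (fun k => _) = (fun k => 2^-1 *
        (B i j + \sum_l visser k i l * visser k l j))); last first.
      by apply/funext => k; rewrite !mxE.
    apply: cvgMl_tmp; apply: cvgD; first exact: cvg_cst.
    apply: cvg_sum => l; apply: cvgM; exact: visser_limP.
  exact: cvg_unique h1 h2.
have sL : L^T = L.
  apply/matrixP => i j; rewrite mxE.
  have h : (fun k => visser k j i) = (fun k => visser k i j).
    by apply/funext => k; rewrite -{1}(psd_sym (psd_nnpoly (nnpoly_visser k).1)) mxE.
  have := @visser_limP j i; rewrite h => h2.
  exact: cvg_unique h2 (@visser_limP i j).
split.
  apply/psdP; split=> [|x]; first by rewrite linearB/= trmx1 sL.
  rewrite mulmxBl mul1mx dotDr dotNr subr_ge0.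
  have h : dot x (visser k *m x) @[k --> \oo] --> dot x (L *m x).
    rewrite dotE; under eq_bigr do rewrite mxE.
    rewrite (_ : (fun k => _) = (fun k => \sum_i x i 0 * \sum_j visser k i j * x j 0)).
      apply: cvg_sum => i; apply: cvgMl_tmp; apply: cvg_sum => j; apply: cvgMr_tmp.
      exact: visser_limP.
    by apply/funext => k; rewrite dotE; under eq_bigr do rewrite mxE.
  rewrite -(cvg_lim _ h)//; apply: limr_le; first exact: cvgP h.
  apply: nearW => k; rewrite -[leRHS]mul1r; apply: opb_qf; exact: opb_visser.
have LL : L *m L = 2 *: L - B.
  by rewrite {3}fixL scalerA divff// scale1r addrAC subrr add0r.
rewrite mulmxBl !mulmxBr !mul1mx mulmx1 LL.
by apply/matrixP => i j; rewrite !mxE; ring.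
Qed.

End iteration.

(** Visser's iteration for [A / t], rescaled, with [t = 1 + normF A] chosen so
    that [0 <= A / t <= 1]. *)
Definition sqrt_iter A k : 'M[R]_n :=
  Num.sqrt (1 + normF A) *:
    (1%:M - visser (1%:M - (1 + normF A)^-1 *: A) k).

(** Existence of the square root comes with an approximation by functions that
    are measurable in the entries of [A]. *)
Lemma cvg_sqrtm A : psd A -> psd (sqrtm A) /\ sqrtm A *m sqrtm A = A /\
  forall i j, sqrt_iter A k i j @[k --> \oo] --> sqrtm A i j.
Proof.
move=> pA; set t := 1 + normF A.
have t0 : 0 < t by rewrite ltr_wpDr ?normF_ge0.
set B := 1%:M - t^-1 *: A.
have sB : B^T = B by rewrite linearB/= linearZ/= trmx1 (psd_sym pA).
have At : opb A t by apply: opbW (opb_normF _); rewrite lerDr.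
have BE x : dot x (B *m x) = dot x x - t^-1 * dot x (A *m x).
  by rewrite mulmxBl mul1mx -scalemxAl !dot_lin.
have pB : psd B.
  apply/psdP; split=> // x; rewrite BE subr_ge0 mulrC ler_pdivrMr// mulrC.
  exact: opb_qf.
have B1 : opb B 1.
  apply: opb_sqr => // x; rewrite expr1n mul1r.
  have hB x' : dot x' (B *m x') <= dot x' x'.
    by rewrite BE gerBl mulr_ge0 ?invr_ge0 ?psd_ge0// ltW.
  have h := psd_cauchy_schwarz (B *m x) x pB.
  have [->|z0] := eqVneq (B *m x) 0; first by rewrite /dot mulmx0 mxE dot_ge0.
  have h2 : dot (B *m x) (B *m x) ^+ 2 <= dot (B *m x) (B *m x) * dot x x.
    by apply: (le_trans h); rewrite ler_pM ?psd_ge0.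
  by move: h2; rewrite expr2 ler_pM2l ?dot_gt0.
have [pS SS] := visser_lim_sqrt pB B1.
pose S := Num.sqrt t *: (1%:M - visser_lim B).
have pS' : psd S.
  apply/psdP; split=> [|x]; first by rewrite linearZ/= (psd_sym pS).
  by rewrite -scalemxAl dotZr mulr_ge0 ?sqrtr_ge0 ?psd_ge0.
have SSA : S *m S = A.
  rewrite -scalemxAl -scalemxAr scalerA -expr2 sqr_sqrtr ?ltW// SS.
  by rewrite opprB addrC subrK scalerA divff ?scale1r// gt_eqF.
have [pQ QQ] : psd (sqrtm A) /\ sqrtm A *m sqrtm A = A.
  rewrite /sqrtm.
  by case: xgetP => [_ -> //|/(_ S) []].
have SE : sqrtm A = S by apply: psd_sqrt_uniq => //; rewrite QQ.
split=> //; split=> // i j; rewrite SE.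
rewrite /sqrt_iter -/t -/B.
have -> : (fun k => (Num.sqrt t *: (1%:M - visser B k)) i j) =
          (fun k => Num.sqrt t * ((1%:M : 'M[R]_n) i j - visser B k i j)).
  by apply/funext => k; rewrite !mxE.
have -> : S i j = Num.sqrt t * ((1%:M : 'M[R]_n) i j - visser_lim B i j).
  by rewrite !mxE.
apply: cvgMl_tmp; apply: cvgB; [exact: cvg_cst|exact: visser_limP].
Qed.

Lemma psd_sqrtm A : psd A -> psd (sqrtm A).
Proof. by move=> /cvg_sqrtm []. Qed.

Lemma sqrtmK A : psd A -> sqrtm A *m sqrtm A = A.
Proof. by move=> /cvg_sqrtm [_ []]. Qed.

Lemma sqrtm_eq A B : psd B -> B *m B = A -> sqrtm A = B.
Proof.
move=> pB BA; have pA : psd A.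
  apply/psdP; rewrite -BA; split=> [|x]; first by rewrite trmx_mul (psd_sym pB).
  by rewrite -mulmxA -dot_symm ?dot_ge0 ?(psd_sym pB).
by apply: psd_sqrt_uniq => //; [exact: psd_sqrtm|rewrite sqrtmK].
Qed.

End square_root.

(** * The Riccati map *)

Section gain.
Context {R : realType} {n : nat}.
Implicit Types A w s : 'M[R]_n.

Lemma psdD A w : psd A -> psd w -> psd (A + w).
Proof.
move=> pA pw; apply/psdP; split=> [|x].
  by rewrite linearD/= (psd_sym pA) (psd_sym pw).
by rewrite mulmxDl dotDr addr_ge0 ?psd_ge0.
Qed.

Lemma psdZ c A : 0 <= c -> psd A -> psd (c *: A).
Proof.
move=> c0 pA; apply/psdP; split=> [|x].
  by rewrite linearZ/= (psd_sym pA).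
by rewrite -scalemxAl dotZr mulr_ge0 ?psd_ge0.
Qed.

Lemma psd_scalar c : 0 <= c -> psd (c%:M : 'M[R]_n).
Proof. by move=> c0; rewrite -scalemx1; apply: psdZ => //; exact: psd1. Qed.

Lemma psd_congr m (M : 'M[R]_(m, n)) A : psd A -> psd (M *m A *m M^T).
Proof.
move=> pA; apply/psdP; split=> [|x].
  by rewrite !trmx_mul trmxK (psd_sym pA) mulmxA.
by rewrite -!mulmxA -{1}[M]trmxK -dot_trmx psd_ge0.
Qed.

Lemma psd_conj s A : s^T = s -> psd A -> psd (s *m A *m s).
Proof. by move=> ss pA; rewrite -{2}ss; exact: psd_congr. Qed.

Lemma psd_invmx A : psd A -> A \in unitmx -> psd (invmx A).
Proof.
move=> pA uA; have sI := trmx_invmx_sym (psd_sym pA).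
apply/psdP; split=> // x.
by rewrite -{1}(mulKVmx uA x) dot_symm ?(psd_sym pA)// psd_ge0.
Qed.

(** The Riccati map in terms of the inverse of its argument, see [riccatiE]. In
    this form it makes sense for singular [A] and is Lipschitz. *)
Definition gain (A : 'M[R]_n) : 'M[R]_n :=
  2 *: invmx (1%:M + sqrtm (1%:M + 4 *: A)).

Section gain_theory.
Variables (A : 'M[R]_n) (pA : psd A).

Let N := sqrtm (1%:M + 4 *: A).
Let P := 1%:M + N.

Let pA4 : psd (1%:M + 4 *: A).
Proof. by apply: psdD; [exact: psd1|exact: psdZ]. Qed.

Lemma psd_discr : psd N. Proof. exact: psd_sqrtm. Qed.

Lemma discrE : N *m N = 1%:M + 4 *: A. Proof. exact: sqrtmK. Qed.

Lemma lowb_succ_discr : lowb P 1.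
Proof.
by move=> x; rewrite mul1r mulmxDl mul1mx dotDr lerDl psd_ge0//; exact: psd_discr.
Qed.

Lemma psd_succ_discr : psd P.
Proof. by apply: psdD; [exact: psd1|exact: psd_discr]. Qed.

Lemma succ_discr_unit : P \in unitmx.
Proof.
apply: spd_unit; apply: lowb_spd lowb_succ_discr => //.
exact: psd_sym psd_succ_discr.
Qed.

Lemma psd_gain : psd (gain A).
Proof.
by apply: psdZ => //; apply: psd_invmx; [exact: psd_succ_discr|exact: succ_discr_unit].
Qed.

Lemma opb_succ_discr_inv : opb (invmx P) 1.
Proof.
by have := invmx_opb ltr01 lowb_succ_discr succ_discr_unit; rewrite invr1.
Qed.

Lemma opb_gain : opb (gain A) 2.
Proof.
have := opbZ 2 opb_succ_discr_inv; rewrite ger0_norm// mulr1; exact.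
Qed.

(** Uses the crude estimate [(1 + 4 A)^(1/2) <= 1 + 4 K]. *)
Lemma lowb_gain K : 0 <= K -> opb A K -> lowb (gain A) (1 + 2 * K)^-1.
Proof.
move=> K0 AK.
have NK : opb N (1 + 4 * K).
  apply: opb_sqr => [|x]; first by rewrite addr_ge0// mulr_ge0.
  rewrite dot_symm ?(psd_sym psd_discr)// mulmxA discrE mulmxDl mul1mx -scalemxAl.
  rewrite dotDr dotZr; have h := opb_qf x AK.
  apply: (@le_trans _ _ ((1 + 4 * K) * dot x x)); first lra.
  by rewrite ler_wpM2r ?dot_ge0// expr2 ler_peMl ?addr_ge0 ?mulr_ge0// lerDl mulr_ge0.
have PK : opb P (2 * (1 + 2 * K)).
  by apply: opbW (opbD (@opb1 _ _) NK); lra.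
have K1 : 0 < 1 + 2 * K by rewrite ltr_pwDl// mulr_ge0.
have h := invmx_lowb psd_succ_discr succ_discr_unit (mulr_gt0 (ltr0Sn _ 1) K1) PK.
move=> x; rewrite -scalemxAl dotZr; have := h x.
by rewrite invfM -mulrA ler_pdivrMl.
Qed.

Let succ_discr_mul : P *m (N - 1%:M) = 4 *: A.
Proof.
rewrite mulmxBr mulmx1 mulmxDl mul1mx discrE /P.
by apply/matrixP => i j; rewrite !mxE; ring.
Qed.

(** [gain A] is the positive root of [r^2 A + r = 1]; with [N] the square root of
    [1 + 4 A] this is [(N^2 - 1) / (1 + N)^2 + 2 / (1 + N) = 1]. *)
Lemma gain_eq : gain A *m gain A *m A + gain A = 1%:M.
Proof.
have -> : gain A *m gain A *m A = invmx P *m (N - 1%:M).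
  rewrite /gain -/N -/P -!(scalemxAl, scalemxAr) scalerA -natrM.
  rewrite -!mulmxA 2!scalemxAr -succ_discr_mul.
  by rewrite [invmx P *m (P *m _)]mulKmx ?succ_discr_unit.
have -> : gain A = invmx P *m 2%:M by rewrite mul_mx_scalar.
rewrite -mulmxDr (_ : N - 1%:M + 2%:M = P) ?mulVmx ?succ_discr_unit//.
by apply/matrixP => i j; rewrite !mxE; ring.
Qed.

Lemma gain_comm : gain A *m A = A *m gain A.
Proof.
have h : A = 4^-1 *: (P *m (P - 2%:M)).
  have -> : P *m (P - 2%:M) = 4 *: A.
    have -> : P - 2%:M = N - 1%:M.
      by apply/matrixP => i j; rewrite !mxE; ring.
    exact: succ_discr_mul.
  by rewrite scalerA mulVf ?scale1r.
have hP : invmx P *m A = A *m invmx P.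
  rewrite {1}h -scalemxAr mulKmx ?succ_discr_unit//.
  rewrite {1}h -scalemxAl.
  have -> : P *m (P - 2%:M) = (P - 2%:M) *m P.
    by rewrite mulmxBr mulmxBl -scalar_mxC.
  by rewrite mulmxK ?succ_discr_unit.
by rewrite /gain -scalemxAl -scalemxAr hP.
Qed.

(** [r A r = 1 - r <= 1] for [r = gain A]. *)
Lemma gain_conj z : dot (gain A *m z) (A *m (gain A *m z)) <= dot z z.
Proof.
rewrite dot_symm ?(psd_sym psd_gain)//.
have -> : gain A *m (A *m (gain A *m z)) = (1%:M - gain A) *m z.
  by rewrite -gain_eq addrK [A *m _]mulmxA -gain_comm !mulmxA.
by rewrite mulmxBl mul1mx dotDr dotNr gerBl psd_ge0//; exact: psd_gain.
Qed.

(** With [r = gain A] and [w = A^-1], [gain_eq] gives [(r + w/2)^2 = w + (w/2)^2]. *)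
Lemma riccatiE : A \in unitmx -> riccati (invmx A) = gain A.
Proof.
move=> uA; set w := invmx A; set r := gain A.
have pw : psd w by exact: psd_invmx.
have rw : r *m w = w *m r.
  by apply: (can_inj (mulKmx uA)); rewrite mulKVmx// mulmxA -gain_comm mulmxK.
have rrw : r *m r + r *m w = w.
  rewrite -[r *m r](mulmxK uA) -/w -mulmxDl.
  by rewrite gain_eq mul1mx.
have -> : riccati w = (r + 2^-1 *: w) - 2^-1 *: w; last by rewrite addrK.
rewrite /riccati; congr (_ - _); apply: sqrtm_eq.
  by apply: psdD; [exact: psd_gain|apply: psdZ => //; rewrite invr_ge0].
rewrite mulmxDl !mulmxDr -[r *m (2^-1 *: w)]scalemxAr -[(2^-1 *: w) *m r]scalemxAl -rw.
rewrite addrA; congr (_ + _); rewrite -addrA -scalerDl.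
by rewrite -{2}rrw (_ : 2^-1 + 2^-1 = 1 :> R) ?scale1r//; field.
Qed.

End gain_theory.

(** The square roots [P], [Q] of [1 + 4 A], [1 + 4 w] are at least [1], hence
    depend on [A], [w] with Lipschitz constant [4], and
    [(1 + P)^-1 - (1 + Q)^-1 = (1 + P)^-1 (Q - P) (1 + Q)^-1]. *)
Lemma gain_lipschitz A w (eta : R) : (0 < n)%N -> 0 <= eta -> psd A -> psd w ->
  opb (A - w) eta -> opb (gain A - gain w) (8 * eta).
Proof.
move=> n0 eta0 pA pw Aw.
have lowb_discr (B : 'M[R]_n) : psd B -> lowb (sqrtm (1%:M + 4 *: B)) 1.
  move=> pB; apply: (psd_sqr_lowb n0 (psd_discr pB) ler01).
  move=> x; rewrite discrE// expr1n mul1r mulmxDl mul1mx -scalemxAl !dot_lin.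
  by rewrite lerDl mulr_ge0 ?psd_ge0.
have d : opb (sqrtm (1%:M + 4 *: w) - sqrtm (1%:M + 4 *: A)) (4 * eta).
  have := sqr_lipschitz n0 (psd_discr pw) (psd_sym (psd_discr pA)) ltr01 (lowb_discr _ pA).
  rewrite !discrE// opprD addrACA subrr add0r -scalerBr.
  move=> /(_ (4 * eta)); rewrite divr1; apply.
  have := opbZ 4 (opbN Aw); rewrite opprB ger0_norm//; exact.
rewrite /gain -scalerBr.
set P := 1%:M + sqrtm (1%:M + 4 *: A); set Q := 1%:M + sqrtm (1%:M + 4 *: w).
have -> : invmx P - invmx Q = invmx P *m (Q - P) *m invmx Q.
  rewrite mulmxBr mulmxBl mulVmx ?succ_discr_unit// mul1mx.
  by rewrite mulmxK ?succ_discr_unit.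
have QP : opb (Q - P) (4 * eta) by rewrite /Q /P opprD addrACA subrr add0r.
have := opbZ 2 (opbM _ (opbM ler01 (opb_succ_discr_inv pA) QP) (opb_succ_discr_inv pw)).
rewrite ger0_norm// !mul1r mulr1 mulrA -natrM; apply.
by rewrite mulr_ge0.
Qed.

End gain.

(** * Covariances of Gaussian bridges *)

Section sqrt_bounds.
Context {R : realType} {n : nat}.
Implicit Types A s : 'M[R]_n.

Lemma enorm_sqrtm A x : psd A -> dot (sqrtm A *m x) (sqrtm A *m x) = dot x (A *m x).
Proof.
by move=> pA; rewrite dot_symm ?(psd_sym (psd_sqrtm pA))// mulmxA sqrtmK.
Qed.

Lemma opb_sqrtm A b : psd A -> 0 <= b -> opb A b -> opb (sqrtm A) (Num.sqrt b).
Proof.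
move=> pA b0 Ab; apply: opb_sqr => [|x]; first exact: sqrtr_ge0.
by rewrite enorm_sqrtm// sqr_sqrtr// opb_qf.
Qed.

Lemma lowb_sqrtm A c : (0 < n)%N -> psd A -> 0 <= c -> lowb A c ->
  lowb (sqrtm A) (Num.sqrt c).
Proof.
move=> n0 pA c0 Ac; apply: (psd_sqr_lowb n0 (psd_sqrtm pA) (sqrtr_ge0 _)).
by rewrite sqrtmK// sqr_sqrtr.
Qed.

Lemma sqrtm_lipschitz A s (c eta : R) : (0 < n)%N -> psd A -> psd s -> 0 < c -> lowb s c ->
  opb (A - s) eta -> opb (sqrtm A - sqrtm s) (eta / Num.sqrt c).
Proof.
move=> n0 pA ps c0 sc As.
apply: (sqr_lipschitz n0 (psd_sqrtm pA) (psd_sym (psd_sqrtm ps))).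
- by rewrite sqrtr_gt0.
- exact: lowb_sqrtm (ltW c0) sc.
- by rewrite !sqrtmK.
Qed.

Lemma opb_conj A s a b : 0 <= a -> 0 <= b -> opb s b -> opb A a ->
  opb (s *m A *m s) (b * a * b).
Proof.
by move=> a0 b0 sb Aa; apply: opbM; [rewrite mulr_ge0|exact: opbM|].
Qed.

Lemma conj_diff A B s t : s *m A *m s - t *m B *m t =
  (s - t) *m A *m s + t *m A *m (s - t) + t *m (A - B) *m t.
Proof.
by rewrite !(mulmxBl, mulmxBr) !addrA !subrK.
Qed.

Lemma conj_lipschitz A B s t (a b e h : R) :
  0 <= a -> 0 <= b -> 0 <= e -> 0 <= h ->
  opb A a -> opb (A - B) h -> opb s b -> opb t b -> opb (s - t) e ->
  opb (s *m A *m s - t *m B *m t) (e * a * b + b * a * e + b * h * b).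
Proof.
move=> a0 b0 e0 h0 Aa ABh sb tb ste; rewrite conj_diff.
have ba : 0 <= b * a by rewrite mulr_ge0.
apply: opbD; first apply: opbD.
- by apply: opbM; [rewrite mulr_ge0|exact: opbM|].
- by apply: opbM => //; exact: opbM.
- by apply: opbM; [rewrite mulr_ge0|exact: opbM|].
Qed.

End sqrt_bounds.

Section bridge_covariance.
Context {R : realType} {n : nat}.
Variables (chi : 'M[R]_n) (k : R).
Hypotheses (k0 : 0 <= k) (chik : opb chi k).

(** Common form of the exact ([e = 0]) and inflated bridge covariances. *)
Definition bridge_cov (e : R) (s vs : 'M[R]_n) : 'M[R]_n :=
  sqrtm vs *m gain (psi chi s vs + e%:M) *m sqrtm vs.

Lemma psd_psi s vs : psd s -> psd vs -> psd (psi chi s vs).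
Proof.
move=> ps pv; apply: psd_conj; first exact: psd_sym (psd_sqrtm pv).
exact: psd_congr.
Qed.

Lemma psd_psi_scalar e s vs : 0 <= e -> psd s -> psd vs ->
  psd (psi chi s vs + e%:M).
Proof. by move=> e0 ps pv; apply: psdD; [exact: psd_psi|exact: psd_scalar]. Qed.

Lemma sqrtm_unit (s : 'M[R]_n) : spd s -> sqrtm s \in unitmx.
Proof.
move=> ss; have := spd_unit ss; rewrite -{1}(sqrtmK (spd_psd ss)) unitmx_mul.
by case/andP.
Qed.

Lemma kappaE s vs : spd (chi *m chi^T) -> spd s -> spd vs ->
  kappa chi s vs = bridge_cov 0 s vs.
Proof.
move=> sc ss sv; have [ps pv] := (spd_psd ss, spd_psd sv).
rewrite /kappa /bridge_cov raddf0 addr0 riccatiE//; first exact: psd_psi.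
have := spd_unit sc; rewrite unitmx_mul => /andP[uc uct].
by rewrite !unitmx_mul (spd_unit ss) uc uct sqrtm_unit.
Qed.

Lemma kappa_epsE e s vs : 0 < e -> psd s -> psd vs ->
  kappa_eps chi e s vs = bridge_cov e s vs.
Proof.
move=> e0 ps pv; rewrite /kappa_eps /bridge_cov riccatiE//.
  by apply: psd_psi_scalar => //; exact: ltW.
have pp := psd_psi_scalar (ltW e0) ps pv.
apply: spd_unit; apply: lowb_spd (psd_sym pp) e0 _ => x.
rewrite mulmxDl mul_scalar_mx dotDr dotZr lerDr psd_ge0//.
exact: psd_psi.
Qed.

Section crude.
Variables (e b : R) (s vs : 'M[R]_n).
Hypotheses (e0 : 0 <= e) (b0 : 0 <= b) (ps : psd s) (pv : psd vs).
Hypothesis (vb : opb vs b).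

Let r := gain (psi chi s vs + e%:M).

Let pr : psd r.
Proof. by apply: psd_gain; exact: psd_psi_scalar. Qed.

Lemma psd_bridge_cov : psd (bridge_cov e s vs).
Proof. by apply: psd_conj => //; exact: psd_sym (psd_sqrtm pv). Qed.

Lemma opb_bridge_cov : opb (bridge_cov e s vs) (2 * b).
Proof.
have := opb_conj (ler0n _ 2) (sqrtr_ge0 b) (opb_sqrtm pv b0 vb)
  (opb_gain (psd_psi_scalar e0 ps pv)).
by rewrite mulrC mulrA -expr2 sqr_sqrtr// mulrC.
Qed.

Lemma opb_sqrtm_bridge_cov :
  opb (sqrtm (bridge_cov e s vs)) (Num.sqrt (2 * b)).
Proof.
apply: opb_sqrtm; [exact: psd_bridge_cov|exact: mulr_ge0|exact: opb_bridge_cov].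
Qed.

(** The factor [kappa chi s^(1/2)] of the drift has covariance
    [kappa chi s chi' kappa <= vs]. *)
Lemma opb_bridge_drift :
  opb (bridge_cov e s vs *m chi *m sqrtm s) (Num.sqrt b).
Proof.
set K := bridge_cov e s vs; set q := sqrtm s; set t := sqrtm vs.
have sK : K^T = K := psd_sym psd_bridge_cov.
have sq : q^T = q := psd_sym (psd_sqrtm ps).
have st : t^T = t := psd_sym (psd_sqrtm pv).
rewrite -[_ *m q]trmxK; apply: opb_tr; first exact: sqrtr_ge0.
apply: opb_sqr => [|x]; first exact: sqrtr_ge0.
rewrite sqr_sqrtr// 2!trmx_mul sK sq.
have -> : q *m (chi^T *m K) *m x = q *m (chi^T *m (K *m x)) by rewrite !mulmxA.
rewrite enorm_sqrtm//; pose z := t *m x.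
have -> : dot (chi^T *m (K *m x)) (s *m (chi^T *m (K *m x)))
    = dot (r *m z) (psi chi s vs *m (r *m z)).
  have -> : K *m x = t *m (r *m z) by rewrite !mulmxA.
  by rewrite /psi -/t dot_trmx trmxK (dot_symm _ _ st) !mulmxA.
apply: (@le_trans _ _ (dot (r *m z) ((psi chi s vs + e%:M) *m (r *m z)))).
  by rewrite mulmxDl mul_scalar_mx dotDr dotZr lerDl mulr_ge0// dot_ge0.
apply: (le_trans (gain_conj (psd_psi_scalar e0 ps pv) z)).
by rewrite enorm_sqrtm//; exact: opb_qf.
Qed.

End crude.

(** [<x, kappa x> = <y, gain y>] with [y = vs^(1/2) x], and [|y|^2 = <x, vs x>]. *)
Lemma lowb_bridge_cov e s vs (c K : R) : 0 <= e -> psd s -> psd vs -> 0 <= c -> 0 <= K ->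
  lowb vs c -> opb (psi chi s vs + e%:M) K ->
  lowb (bridge_cov e s vs) ((1 + 2 * K)^-1 * c).
Proof.
move=> e0 ps pv c0 K0 vc pK x.
have st := psd_sym (psd_sqrtm pv).
rewrite /bridge_cov -!mulmxA -dot_symm//.
apply: le_trans (lowb_gain (psd_psi_scalar e0 ps pv) K0 pK _).
rewrite enorm_sqrtm// -mulrA ler_wpM2l//.
by rewrite invr_ge0 addr_ge0// mulr_ge0.
Qed.

End bridge_covariance.

(** Constants for estimates [vsh] at distance at most [1] from [vs]: [Cs] bounds
    the square roots of [s], [vs] and [vsh]; [Cpsi], [Ccov] and [Cbridge] are Lipschitz
    constants of [psi], of the bridge covariance, and of the coefficients of the
    bridge; [Clow] is a lower bound for the exact bridge covariance. *)
Section constants.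
Context {R : realType}.
Variables (Cl Cu k : R).

Definition Cs := Num.sqrt (Cu + 1).
Definition Cpsi := 2 * (Cs * (k * Cu * k)) / Num.sqrt Cl + Cs * (k * k) * Cs + 1.
Definition Ccov := 4 * Cs / Num.sqrt Cl + 8 * Cs ^+ 2 * Cpsi.
Definition Clow := (1 + 2 * (Cs * (k * Cu * k) * Cs))^-1 * Cl.
Definition Cbridge :=
  Ccov / Num.sqrt Clow + (Ccov * k * Cs + Cs * 2 * Cs * k / Num.sqrt Cl).

End constants.

(** One pair of points, with exact covariances [s], [vs] between [Cl] and [Cu]
    and estimates [sh], [vsh] at distance at most [ds], [dv]. *)
Section pointwise.
Context {R : realType} {n : nat}.
Variables (chi : 'M[R]_n) (k Cl Cu eps ds dv : R).
Variables (s vs sh vsh : 'M[R]_n).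
Hypotheses (n0 : (0 < n)%N) (k0 : 0 <= k) (chik : opb chi k).
Hypotheses (Cl0 : 0 < Cl) (Cu0 : 0 <= Cu) (eps0 : 0 <= eps) (ds0 : 0 <= ds) (dv0 : 0 <= dv).
Hypotheses (ps : psd s) (pv : psd vs) (psh : psd sh) (pvh : psd vsh).
Hypotheses (sl : lowb s Cl) (vl : lowb vs Cl) (su : opb s Cu) (vu : opb vs Cu).
Hypotheses (shs : opb (sh - s) ds) (vhv : opb (vsh - vs) dv).
Let K := bridge_cov chi 0 s vs.
Let Kh := bridge_cov chi eps sh vsh.

Lemma opb_sqrtm_diff : opb (sqrtm sh - sqrtm s) (ds / Num.sqrt Cl).
Proof. exact: sqrtm_lipschitz. Qed.

Lemma opb_drift_crude b : 0 <= b -> opb vsh b ->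
  opb (Kh *m chi *m sqrtm sh - K *m chi *m sqrtm s) (Num.sqrt b + Num.sqrt Cu).
Proof.
by move=> b0 vb; apply: opbB; apply: opb_bridge_drift.
Qed.

Lemma opb_noise_crude b : 0 <= b -> opb vsh b ->
  opb (sqrtm Kh - sqrtm K) (Num.sqrt (2 * b) + Num.sqrt (2 * Cu)).
Proof.
by move=> b0 vb; apply: opbB; apply: opb_sqrtm_bridge_cov.
Qed.

Hypothesis dv1 : dv <= 1.

Let eta := ds + dv + eps.
Let H := Cs Cu.
Let c := Num.sqrt Cl.

Let H0 : 0 <= H. Proof. exact: sqrtr_ge0. Qed.
Let c0 : 0 < c. Proof. by rewrite sqrtr_gt0. Qed.
Let Cu1 : 0 <= Cu + 1. Proof. by rewrite addr_ge0. Qed.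

Let vHu : opb vs (Cu + 1). Proof. by apply: opbW vu; rewrite lerDl. Qed.
Let vhHu : opb vsh (Cu + 1).
Proof.
have := opbD vu (opbW dv1 vhv); rewrite addrCA subrr addr0; exact.
Qed.
Let vH : opb (sqrtm vs) H. Proof. exact: opb_sqrtm. Qed.
Let vhH : opb (sqrtm vsh) H. Proof. exact: opb_sqrtm. Qed.
Let sH : opb (sqrtm s) H.
Proof. by apply: opb_sqrtm => //; apply: opbW su; rewrite lerDl. Qed.

Let dvh : opb (sqrtm vsh - sqrtm vs) (dv / c).
Proof. exact: sqrtm_lipschitz. Qed.

Let dc0 : 0 <= dv / c. Proof. by rewrite divr_ge0// ltW. Qed.

Let chi_conj (M : 'M[R]_n) a : 0 <= a -> opb M a -> opb (chi *m M *m chi^T) (k * a * k).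
Proof.
by move=> a0 Ma; apply: opbM; [exact: mulr_ge0|exact: opbM|exact: opb_tr].
Qed.

Let opb_psi_diff :
  opb ((psi chi sh vsh + eps%:M) - (psi chi s vs + 0%:M)) (Cpsi Cl Cu k * eta).
Proof.
have kk0 : 0 <= k * Cu * k by rewrite !mulr_ge0.
have kd0 : 0 <= k * ds * k by rewrite !mulr_ge0.
have h1 := conj_lipschitz kk0 H0 dc0 kd0 (chi_conj Cu0 su) _ vH vhH.
have {}h1 := h1 (chi *m sh *m chi^T).
have h2 : opb (chi *m s *m chi^T - chi *m sh *m chi^T) (k * ds * k).
  rewrite -mulmxBl -mulmxBr -[s - sh]opprB; apply: chi_conj => //; exact: opbN.
have h3 : opb (sqrtm vs - sqrtm vsh) (dv / c) by rewrite -opprB; exact: opbN.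
have {}h1 := h1 h2 h3.
have h4 : opb (eps%:M : 'M[R]_n) eps.
  by have := opbZ eps (@opb1 R n); rewrite ger0_norm// mulr1 scalemx1.
have := opbD (opbN h1) h4; rewrite opprB raddf0 addr0 addrAC.
move=> h; apply: opbW h; rewrite /Cpsi -/H -/c /eta.
have hh : 0 <= H * (k * k) * H by rewrite !mulr_ge0.
have hl : 0 <= 2 * (H * (k * Cu * k)) / c by rewrite divr_ge0 ?mulr_ge0// ltW.
have e1 : dv / c * (k * Cu * k) * H + H * (k * Cu * k) * (dv / c)
    = 2 * (H * (k * Cu * k)) / c * dv by ring.
have e2 : H * (k * ds * k) * H = H * (k * k) * H * ds by ring.
rewrite e1 e2.
set p := 2 * (H * (k * Cu * k)) / c in hl *.
set q := H * (k * k) * H in hh *.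
have := mulr_ge0 hl ds0; have := mulr_ge0 hl eps0.
have := mulr_ge0 hh dv0; have := mulr_ge0 hh eps0.
move: ds0 dv0; lra.
Qed.

Let Cpsi0 : 0 <= Cpsi Cl Cu k.
Proof.
by rewrite /Cpsi -/H -/c !addr_ge0// ?divr_ge0 ?mulr_ge0// ltW.
Qed.

Let eta0 : 0 <= eta. Proof. by rewrite !addr_ge0. Qed.

Let opb_cov_diff : opb (Kh - K) (Ccov Cl Cu k * eta).
Proof.
have pp := psd_psi_scalar chi eps0 psh pvh.
have pp0 := psd_psi_scalar chi (lexx 0) ps pv.
have pe : 0 <= Cpsi Cl Cu k * eta by rewrite mulr_ge0.
have g8 : 0 <= 8 * (Cpsi Cl Cu k * eta) by rewrite mulr_ge0.
have hd := gain_lipschitz n0 pe pp pp0 opb_psi_diff.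
have h := conj_lipschitz (ler0n R 2) H0 dc0 g8 (opb_gain pp) hd vhH vH dvh.
apply: opbW h; rewrite /Ccov -/H -/c.
have : 0 <= 4 * H / c by rewrite divr_ge0 ?mulr_ge0// ltW.
rewrite (_ : dv / c * 2 * H + H * 2 * (dv / c) = 4 * H / c * dv); last by ring.
rewrite (_ : H * (8 * (Cpsi Cl Cu k * eta)) * H =
  8 * H ^+ 2 * Cpsi Cl Cu k * eta); last by ring.
move=> hp; rewrite [leRHS]mulrDl lerD2r ler_wpM2l//.
by rewrite /eta; move: ds0 eps0; lra.
Qed.

Let Ccov0 : 0 <= Ccov Cl Cu k.
Proof.
by rewrite /Ccov -/H -/c addr_ge0// ?divr_ge0 ?mulr_ge0 ?sqr_ge0// ltW.
Qed.

Let Clow0 : 0 < Clow Cl Cu k.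
Proof.
by rewrite /Clow mulr_gt0// invr_gt0 ltr_pwDl// !mulr_ge0// sqrtr_ge0.
Qed.

Lemma Cbridge_ge0 : 0 <= Cbridge Cl Cu k.
Proof.
rewrite /Cbridge -/H -/c addr_ge0//; first by rewrite divr_ge0// sqrtr_ge0.
by apply: addr_ge0; [rewrite !mulr_ge0|rewrite divr_ge0 ?mulr_ge0// ltW].
Qed.

(** Only the exact covariance [K] is bounded below, which is what
    [sqrtm_lipschitz] needs. *)
Lemma opb_noise_fine : opb (sqrtm Kh - sqrtm K) (Cbridge Cl Cu k * eta).
Proof.
have pK : psd K by exact: psd_bridge_cov.
have pKh : psd Kh by exact: psd_bridge_cov.
have kk0 : 0 <= k * Cu * k by rewrite !mulr_ge0.
have h0 : 0 <= H * (k * Cu * k) * H by rewrite !mulr_ge0.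
have Kl : lowb K (Clow Cl Cu k).
  apply: lowb_bridge_cov => //; first exact: ltW.
  by rewrite raddf0 addr0; apply: opb_conj => //; exact: chi_conj.
have := sqrtm_lipschitz n0 pKh pK Clow0 Kl opb_cov_diff.
apply: opbW; rewrite mulrAC /Cbridge [leRHS]mulrDl lerDl mulr_ge0// addr_ge0//.
  by rewrite !mulr_ge0.
by rewrite divr_ge0 ?mulr_ge0// ltW.
Qed.

Lemma opb_drift_fine :
  opb (Kh *m chi *m sqrtm sh - K *m chi *m sqrtm s) (Cbridge Cl Cu k * eta).
Proof.
have -> : Kh *m chi *m sqrtm sh - K *m chi *m sqrtm s =
    (Kh - K) *m chi *m sqrtm s + Kh *m chi *m (sqrtm sh - sqrtm s).
  by rewrite mulmxBr !mulmxBl [RHS]addrC addrA subrK.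
have hq := sqrtm_lipschitz n0 psh ps Cl0 sl shs.
have gg : opb (gain (psi chi sh vsh + eps%:M)) 2.
  by apply: opb_gain; exact: psd_psi_scalar.
have hK : opb Kh (H * 2 * H) by exact: opb_conj.
have HH : 0 <= H * 2 * H by rewrite !mulr_ge0.
have Ce : 0 <= Ccov Cl Cu k * eta by rewrite mulr_ge0.
have h1 : opb ((Kh - K) *m chi *m sqrtm s) (Ccov Cl Cu k * eta * k * H).
  by apply: opbM => //; [exact: mulr_ge0|exact: opbM].
have h2 : opb (Kh *m chi *m (sqrtm sh - sqrtm s)) (H * 2 * H * k * (ds / c)).
  by apply: opbM => //; [exact: mulr_ge0|exact: opbM].
apply: opbW (opbD h1 h2); rewrite /Cbridge -/H -/c [leRHS]mulrDl [X in _ <= _ + X]mulrDl.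
have a1 : 0 <= Ccov Cl Cu k / Num.sqrt (Clow Cl Cu k) * eta.
  by rewrite mulr_ge0// divr_ge0// sqrtr_ge0.
rewrite (_ : Ccov Cl Cu k * eta * k * H = Ccov Cl Cu k * k * H * eta); last by ring.
rewrite (_ : H * 2 * H * k * (ds / c) = H * 2 * H * k / c * ds); last by ring.
have : H * 2 * H * k / c * ds <= H * 2 * H * k / c * eta.
  rewrite ler_wpM2l//; first by rewrite divr_ge0 ?mulr_ge0// ltW.
  by rewrite /eta; move: dv0 eps0; lra.
lra.
Qed.

End pointwise.

(** * The transport cost between two models at given points *)

Section pointwise_cost.
Context {R : realType} {n : nat}.

(** The factor [3] is the number of terms in the second sum. *)
Lemma le_cost_opb (T0 T1 T2 : 'M[R]_n) (t0 t1 t2 M : R) (a b g h : 'cV[R]_n) :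
  0 <= t0 -> 0 <= t1 -> 0 <= t2 -> opb T0 t0 -> opb T1 t1 -> opb T2 t2 ->
  t0 ^+ 2 + t1 ^+ 2 <= M -> t2 ^+ 2 <= M ->
  enorm (a + T0 *m g) ^+ 2 + enorm (b + T1 *m g + T2 *m h) ^+ 2 <=
  3 * (enorm a ^+ 2 + enorm b ^+ 2 + M * (dot g g + dot h h)).
Proof.
move=> t00 t10 t20 T0t T1t T2t M1 M2.
have e0 := @enorm_ge0 R n.
have h1 : enorm (a + T0 *m g) <= enorm a + t0 * enorm g.
  by apply: (le_trans (enormD _ _)); rewrite lerD2l.
have h2 : enorm (b + T1 *m g + T2 *m h) <= enorm b + t1 * enorm g + t2 * enorm h.
  apply: (le_trans (enormD _ _)); apply: lerD => //.
  by apply: (le_trans (enormD _ _)); rewrite lerD2l.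
have sq (x y : R) : 0 <= x -> x <= y -> x ^+ 2 <= y ^+ 2.
  by move=> x0 xy; rewrite lerXn2r ?nnegrE// (le_trans x0).
have {}h1 := sq _ _ (e0 _) h1; have {}h2 := sq _ _ (e0 _) h2.
rewrite -!sqr_enorm; move: h1 h2.
set x1 := enorm (a + _); set x2 := enorm (b + _ + _).
move: (enorm a) (enorm b) (enorm g) (enorm h) => A B c e h1 h2.
have i1 : (A + t0 * c) ^+ 2 <= 3 * (A ^+ 2 + t0 ^+ 2 * c ^+ 2).
  have := sqr_ge0 (A - t0 * c); have := sqr_ge0 A; have := sqr_ge0 (t0 * c); nra.
have i2 : (B + t1 * c + t2 * e) ^+ 2 <=
    3 * (B ^+ 2 + t1 ^+ 2 * c ^+ 2 + t2 ^+ 2 * e ^+ 2).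
  have := sqr_ge0 (B - t1 * c); have := sqr_ge0 (B - t2 * e).
  have := sqr_ge0 (t1 * c - t2 * e); nra.
have j1 : (t0 ^+ 2 + t1 ^+ 2) * c ^+ 2 <= M * c ^+ 2 by rewrite ler_wpM2r ?sqr_ge0.
have j2 : t2 ^+ 2 * e ^+ 2 <= M * e ^+ 2 by rewrite ler_wpM2r ?sqr_ge0.
lra.
Qed.

Variables (chi : 'M[R]_n) (k Cl Cu eps ds dv : R).
Variables (s vs sh vsh : 'M[R]_n).
Hypotheses (n0 : (0 < n)%N) (k0 : 0 <= k) (chik : opb chi k).
Hypotheses (Cl0 : 0 < Cl) (Cu0 : 0 <= Cu) (eps0 : 0 <= eps) (ds0 : 0 <= ds) (dv0 : 0 <= dv).
Hypotheses (ps : psd s) (pv : psd vs) (psh : psd sh) (pvh : psd vsh).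
Hypotheses (sl : lowb s Cl) (vl : lowb vs Cl) (su : opb s Cu) (vu : opb vs Cu).
Hypotheses (shs : opb (sh - s) ds) (vhv : opb (vsh - vs) dv).

Let K := bridge_cov chi 0 s vs.
Let Kh := bridge_cov chi eps sh vsh.

(** Squared distance between the outputs of the estimated and exact models when
    they share the noises [g] and [h]; [a] and [b] are the differences of the
    means. *)
Definition cost_vec (a b g h : 'cV[R]_n) : R :=
  enorm (a + (sqrtm sh - sqrtm s) *m g) ^+ 2 +
  enorm (b + (Kh *m chi *m sqrtm sh - K *m chi *m sqrtm s) *m g
           + (sqrtm Kh - sqrtm K) *m h) ^+ 2.

Let t0E : (ds / Num.sqrt Cl) ^+ 2 = Cl^-1 * ds ^+ 2.
Proof. by rewrite expr_div_n sqr_sqrtr ?ltW// mulrC. Qed.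

Let t00 : 0 <= ds / Num.sqrt Cl.
Proof. by rewrite divr_ge0. Qed.

Let le_sqr_sqrtD (x y : R) : 0 <= x -> 0 <= y ->
  (Num.sqrt x + Num.sqrt y) ^+ 2 <= 2 * (x + y).
Proof.
move=> x0 y0; have := sqr_ge0 (Num.sqrt x - Num.sqrt y).
have := sqr_sqrtr x0; have := sqr_sqrtr y0.
move: (Num.sqrt x) (Num.sqrt y) => p q; nra.
Qed.

Let crude_bound b (a a' g h : 'cV[R]_n) M : 0 <= b -> opb vsh b ->
  Cl^-1 * ds ^+ 2 + 4 * (b + Cu) <= M ->
  cost_vec a a' g h <= 3 * (enorm a ^+ 2 + enorm a' ^+ 2 + M * (dot g g + dot h h)).
Proof.
move=> b0 vb HM.
have d0 : 0 <= Cl^-1 * ds ^+ 2 by rewrite mulr_ge0 ?sqr_ge0// invr_ge0 ltW.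
have bC : 0 <= b + Cu by rewrite addr_ge0.
rewrite /cost_vec; apply: (le_cost_opb _ _ _ _ t00 _ _ (opb_sqrtm_diff n0 Cl0 ps psh sl shs)
  (opb_drift_crude chi Cu0 eps0 ps pv psh pvh vu b0 vb)
  (opb_noise_crude chi Cu0 eps0 ps pv psh pvh vu b0 vb)).
- by rewrite addr_ge0.
- by rewrite addr_ge0.
- have := le_sqr_sqrtD b0 Cu0; rewrite t0E; move: HM; lra.
- have := le_sqr_sqrtD (mulr_ge0 (ler0n R 2) b0) (mulr_ge0 (ler0n R 2) Cu0).
  move: HM; lra.
Qed.

Definition Ccrude (Cl Cu : R) := Cl^-1 + 4 + 4 * Cu.

Lemma cost_crude (a a' g h : 'cV[R]_n) : cost_vec a a' g h <=
  3 * (enorm a ^+ 2 + enorm a' ^+ 2 +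
       Ccrude Cl Cu * (ds ^+ 2 + (1 + opnorm vsh)) * (dot g g + dot h h)).
Proof.
have b0 := opnorm_ge0 vsh.
apply: (crude_bound _ _ _ _ b0 (opb_opnorm vsh)).
have i0 : 0 <= Cl^-1 by rewrite invr_ge0 ltW.
have := mulr_ge0 i0 b0; have := mulr_ge0 Cu0 b0; have := mulr_ge0 Cu0 (sqr_ge0 ds).
have := sqr_ge0 ds; rewrite /Ccrude; move: i0 b0 Cu0; nra.
Qed.

Definition Cfine (Cl Cu k : R) := Cl^-1 + 3 * Cbridge Cl Cu k ^+ 2 + 8 * Cu + 4.

(** If [dv <= 1] the Lipschitz bounds hold. Otherwise [1 <= dv <= dv^2] and
    [|vsh| <= Cu + dv], so the crude bound is of order [ds^2 + dv^2]. *)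
Lemma cost_fine (a a' g h : 'cV[R]_n) : cost_vec a a' g h <=
  3 * (enorm a ^+ 2 + enorm a' ^+ 2 +
       Cfine Cl Cu k * (ds ^+ 2 + (dv ^+ 2 + eps ^+ 2)) * (dot g g + dot h h)).
Proof.
have i0 : 0 <= Cl^-1 by rewrite invr_ge0 ltW.
have E0 : 0 <= ds ^+ 2 + (dv ^+ 2 + eps ^+ 2) by rewrite !addr_ge0 ?sqr_ge0.
have [dv1|/ltW dv1] := leP dv 1.
- have B0 : 0 <= Cbridge Cl Cu k * (ds + dv + eps).
    by rewrite mulr_ge0 ?Cbridge_ge0// !addr_ge0.
  have e3 : (ds + dv + eps) ^+ 2 <= 3 * (ds ^+ 2 + (dv ^+ 2 + eps ^+ 2)).
    have := sqr_ge0 (ds - dv); have := sqr_ge0 (ds - eps).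
    have := sqr_ge0 (dv - eps); nra.
  have B3 : (Cbridge Cl Cu k * (ds + dv + eps)) ^+ 2 <=
      3 * Cbridge Cl Cu k ^+ 2 * (ds ^+ 2 + (dv ^+ 2 + eps ^+ 2)).
    move: (Cbridge Cl Cu k) e3 => t; move: (ds + dv + eps) (ds ^+ 2 + _) => x y xy.
    have := ler_wpM2l (sqr_ge0 t) xy; rewrite -exprMn => /le_trans; apply.
    by rewrite mulrCA mulrA.
  have E1 : Cl^-1 * ds ^+ 2 <= Cl^-1 * (ds ^+ 2 + (dv ^+ 2 + eps ^+ 2)).
    by rewrite ler_wpM2l// lerDl addr_ge0 ?sqr_ge0.
  have E2 : 0 <= (8 * Cu + 4) * (ds ^+ 2 + (dv ^+ 2 + eps ^+ 2)).
    by rewrite mulr_ge0// addr_ge0// mulr_ge0.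
  have E3 : 0 <= Cl^-1 * (ds ^+ 2 + (dv ^+ 2 + eps ^+ 2)) by exact: mulr_ge0.
  have CE : Cfine Cl Cu k * (ds ^+ 2 + (dv ^+ 2 + eps ^+ 2)) =
      Cl^-1 * (ds ^+ 2 + (dv ^+ 2 + eps ^+ 2)) +
      3 * Cbridge Cl Cu k ^+ 2 * (ds ^+ 2 + (dv ^+ 2 + eps ^+ 2)) +
      (8 * Cu + 4) * (ds ^+ 2 + (dv ^+ 2 + eps ^+ 2)).
    by rewrite /Cfine; ring.
  rewrite /cost_vec; apply: (le_cost_opb _ _ _ _ t00 B0 B0
    (opb_sqrtm_diff n0 Cl0 ps psh sl shs)
    (opb_drift_fine n0 k0 chik Cl0 Cu0 eps0 ds0 dv0 ps pv psh pvh sl vl su vu shs vhv dv1)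
    (opb_noise_fine n0 k0 chik Cl0 Cu0 eps0 ds0 dv0 ps pv psh pvh vl su vu shs vhv dv1)).
  + by rewrite t0E CE -[leLHS]addr0 lerD// lerD.
  + by rewrite CE -[leLHS]addr0 lerD// -[leLHS]add0r lerD.
- have vb : opb vsh (Cu + dv).
    by have := opbD vu vhv; rewrite addrCA subrr addr0.
  apply: (crude_bound _ _ _ _ _ vb); first exact: addr_ge0.
  have B0 : 0 <= 3 * Cbridge Cl Cu k ^+ 2 * (ds ^+ 2 + (dv ^+ 2 + eps ^+ 2)).
    by rewrite mulr_ge0// mulr_ge0// sqr_ge0.
  have E1 : Cl^-1 * ds ^+ 2 <= Cl^-1 * (ds ^+ 2 + (dv ^+ 2 + eps ^+ 2)).
    by rewrite ler_wpM2l// lerDl addr_ge0 ?sqr_ge0.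
  have dd : dv <= dv ^+ 2 by rewrite expr2 ler_peMl.
  have d1 : 1 <= dv ^+ 2 by apply: le_trans dd.
  have E2 : (8 * Cu + 4) * dv ^+ 2 <= (8 * Cu + 4) * (ds ^+ 2 + (dv ^+ 2 + eps ^+ 2)).
    rewrite ler_wpM2l//; first by rewrite addr_ge0// mulr_ge0.
    by have := sqr_ge0 ds; have := sqr_ge0 eps; lra.
  have E3 : 8 * Cu <= 8 * Cu * dv ^+ 2 by rewrite ler_peMr// mulr_ge0.
  rewrite /Cfine; lra.
Qed.

End pointwise_cost.

(** * Measurability of matrix functions *)

Section measurable_matrix_functions.
Context {R : realType} {d : measure_display} {T : measurableType d}.

Lemma measurable_sqrtr (f : T -> R) :
  measurable_fun setT f -> measurable_fun setT (fun t => Num.sqrt (f t)).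
Proof.
move=> mf; apply: measurableT_comp => //.
exact: continuous_measurable_fun (@sqrt_continuous R).
Qed.

(** [x^-1 = x (x^2)^-1] reduces the claim to a power of a nonnegative number. *)
Lemma measurable_invr (f : T -> R) :
  measurable_fun setT f -> measurable_fun setT (fun t => (f t)^-1).
Proof.
move=> mf; have invE (x : R) : x^-1 = x * (x ^+ 2) `^ (-1).
  rewrite powR_inv1 ?sqr_ge0//; have [->|x0] := eqVneq x 0.
    by rewrite invr0 mul0r.
  by rewrite expr2 invfM mulrA divff// mul1r.
under eq_fun do rewrite invE.
apply: measurable_funM => //.
by apply: (measurableT_comp (@measurable_powR R (-1))); exact: measurable_funX.
Qed.

Lemma measurable_entryT m n (f : T -> 'M[R]_(m, n)) i j :
  measurable_fun setT f -> measurable_fun setT (fun t => f t i j).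
Proof. by move=> mf; exact: measurableT_comp (measurable_entry i j) mf. Qed.

Lemma measurable_addmx m n (f g : T -> 'M[R]_(m, n)) :
  measurable_fun setT f -> measurable_fun setT g ->
  measurable_fun setT (fun t => f t + g t).
Proof.
move=> mf mg; apply: measurable_mx => i j; under eq_fun do rewrite mxE.
by apply: measurable_funD; exact: measurable_entryT.
Qed.

Lemma measurable_scalemx m n (c : T -> R) (f : T -> 'M[R]_(m, n)) :
  measurable_fun setT c -> measurable_fun setT f ->
  measurable_fun setT (fun t => c t *: f t).
Proof.
move=> mc mf; apply: measurable_mx => i j; under eq_fun do rewrite mxE.
by apply: measurable_funM => //; exact: measurable_entryT.
Qed.

Lemma measurable_oppmx m n (f : T -> 'M[R]_(m, n)) :
  measurable_fun setT f -> measurable_fun setT (fun t => - f t).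
Proof.
move=> mf; under eq_fun do rewrite -scaleN1r.
by apply: measurable_scalemx.
Qed.

Lemma measurable_submx m n (f g : T -> 'M[R]_(m, n)) :
  measurable_fun setT f -> measurable_fun setT g ->
  measurable_fun setT (fun t => f t - g t).
Proof. by move=> mf mg; apply: measurable_addmx => //; exact: measurable_oppmx. Qed.

Lemma measurable_mulmx m n p (f : T -> 'M[R]_(m, n)) (g : T -> 'M[R]_(n, p)) :
  measurable_fun setT f -> measurable_fun setT g ->
  measurable_fun setT (fun t => f t *m g t).
Proof.
move=> mf mg; apply: measurable_mx => i j; under eq_fun do rewrite mxE.
apply: measurable_sum => k.
by apply: measurable_funM; exact: measurable_entryT.
Qed.

Lemma measurable_normF m n (f : T -> 'M[R]_(m, n)) :
  measurable_fun setT f -> measurable_fun setT (fun t => normF (f t)).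
Proof.
move=> mf; apply: measurable_sqrtr.
apply: measurable_sum => i; apply: measurable_sum => j.
by apply: measurable_funX; exact: measurable_entryT.
Qed.

Lemma measurable_enorm n (f : T -> 'cV[R]_n) :
  measurable_fun setT f -> measurable_fun setT (fun t => enorm (f t)).
Proof.
move=> mf; apply: measurable_sqrtr.
by apply: measurable_sum => i; apply: measurable_funX; exact: measurable_entryT.
Qed.

Lemma measurable_det n (f : T -> 'M[R]_n) :
  measurable_fun setT f -> measurable_fun setT (fun t => \det (f t)).
Proof.
move=> mf; apply: measurable_sum => s; apply: measurable_funM => //.
by apply: measurable_prod => i _; exact: measurable_entryT.
Qed.

Lemma measurable_invmx n (f : T -> 'M[R]_n) :
  measurable_fun setT f -> (forall t, f t \in unitmx) ->
  measurable_fun setT (fun t => invmx (f t)).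
Proof.
move=> mf uf.
rewrite (_ : (fun t => _) = (fun t => (\det (f t))^-1 *: \adj (f t))); last first.
  by apply/funext => t; rewrite /invmx uf.
apply: measurable_scalemx.
  by apply: measurable_invr; exact: measurable_det.
apply: measurable_mx => i j.
under eq_fun do rewrite mxE.
apply: measurable_funM => //; apply: measurable_det.
apply: measurable_mx => k l; under eq_fun do rewrite !mxE.
exact: measurable_entryT.
Qed.

Lemma measurable_sqrtm n (f : T -> 'M[R]_n) :
  measurable_fun setT f -> (forall t, psd (f t)) ->
  measurable_fun setT (fun t => sqrtm (f t)).
Proof.
move=> mf pf; apply: measurable_mx => i j.
apply: (measurable_fun_cvg (h := fun k t => sqrt_iter (f t) k i j)); last first.
  by move=> t _; have [_ [_]] := cvg_sqrtm (pf t); exact.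
move=> k; apply: measurable_entryT.
have mF : measurable_fun setT (fun t => 1 + normF (f t)).
  by apply: measurable_funD => //; exact: measurable_normF.
apply: measurable_scalemx.
  exact: measurable_sqrtr.
apply: measurable_submx => //.
elim: k => [|k IH] //=.
apply: measurable_scalemx => //; apply: measurable_addmx; last exact: measurable_mulmx.
apply: measurable_submx => //; apply: measurable_scalemx => //.
exact: measurable_invr.
Qed.

(** The matrix [psi] may be singular; measurability rests on [gain], whose only
    inverse is that of a matrix above the identity. *)
Lemma measurable_bridge_cov n (chi : 'M[R]_n) e (f g : T -> 'M[R]_n) :
  0 <= e -> measurable_fun setT f -> measurable_fun setT g ->
  (forall t, psd (f t)) -> (forall t, psd (g t)) ->
  measurable_fun setT (fun t => bridge_cov chi e (f t) (g t)).
Proof.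
move=> e0 mf mg pf pg; have ms := measurable_sqrtm mg pg.
apply: measurable_mulmx => //; apply: measurable_mulmx => //.
have pp t : psd (psi chi (f t) (g t) + e%:M) by exact: psd_psi_scalar.
apply: measurable_scalemx => //; apply: measurable_invmx; last first.
  by move=> t; exact: succ_discr_unit.
apply: measurable_addmx => //; apply: measurable_sqrtm; last first.
  by move=> t; apply: psdD; [exact: psd1|exact: psdZ].
apply: measurable_addmx => //; apply: measurable_scalemx => //.
apply: measurable_addmx => //.
by do 4?[apply: measurable_mulmx => //].
Qed.

End measurable_matrix_functions.

(** * Lower integrals and image measures *)

Import HBNNSimple.

Section lower_integral.
Local Open Scope ereal_scope.
Context {d : measure_display} {T : measurableType d} {R : realType}.

(** [\int[mu]] of a nonnegative function that need not be measurable is its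
    lower integral, which is monotone. *)
Lemma le_lower_integral (mu : {measure set T -> \bar R}) (f g : T -> \bar R) :
  (forall x, 0 <= f x) -> (forall x, f x <= g x) ->
  \int[mu]_x f x <= \int[mu]_x g x.
Proof.
move=> f0 fg; have g0 x : 0 <= g x by exact: le_trans (fg x).
rewrite !ge0_integralTE//; apply: ereal_sup_le => _ [h /= hf <-].
by exists h => //= x; exact: le_trans (fg x).
Qed.

(** [w] need not be measurable: outside a null set it dominates the measurable
    function [max 0 ((H - f) / c)]. *)
Lemma integral_le_add_lower (mu : probability T R) (H : T -> \bar R)
    (f w : T -> R) (c : R) :
  measurable_fun setT H -> (forall x, 0 <= H x) ->
  measurable_fun setT f -> (forall x, (0 <= f x)%R) -> (forall x, (0 <= w x)%R) -> (0 < c)%R ->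
  {ae mu, forall x, H x <= (f x + c * w x)%:E} ->
  \int[mu]_x H x <= \int[mu]_x (f x)%:E + c%:E * \int[mu]_x (w x)%:E.
Proof.
move=> mH H0 mf f0 w0 c0 [N [mN N0 subN]].
pose G x := maxe 0 ((c^-1)%:E * (H x - (f x)%:E)) * (\1_(~` N) x)%:E.
have G0 x : 0 <= G x by rewrite mule_ge0 ?lee_fin// le_max lexx.
have mG : measurable_fun setT G.
  apply: emeasurable_funM; last first.
    by apply/measurable_EFinP; apply: measurable_indic; exact: measurableC.
  apply: measurable_maxe => //; apply: emeasurable_funM => //.
  by apply: emeasurable_funB => //; exact/measurable_EFinP.
have HN x : ~ N x -> H x <= (f x + c * w x)%:E.
  by move=> Nx; apply: contrapT => /subN.
have Gw x : G x <= (w x)%:E.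
  rewrite /G indicE; have [xN|xN] := boolP (x \in ~` N); last first.
    by rewrite mule0 lee_fin.
  rewrite mule1 ge_max lee_fin w0/=; move: xN; rewrite inE => /HN.
  case: (H x) (H0 x) => // r _; rewrite -EFinB -EFinM !lee_fin => h.
  by rewrite mulrC ler_pdivrMr// mulrC lerBlDl.
have HG : {ae mu, forall x, H x <= (f x)%:E + c%:E * G x}.
  exists N; split=> // x; apply: contra_notP => Nx.
  rewrite /= /G indicE mem_set// mule1.
  have := HN _ Nx; case: (H x) (H0 x) => // r _ _.
  rewrite -EFinB -EFinM -EFin_max -EFinM -EFinD lee_fin -lerBlDl.
  by rewrite maxr_pMr ?(ltW c0)// mulrA divff ?gt_eqF// mul1r le_max lexx orbT.
apply: (@le_trans _ _ (\int[mu]_x ((f x)%:E + c%:E * G x))).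
  apply: ae_ge0_le_integral => //.
  - by move=> x _; rewrite adde_ge0 ?lee_fin// mule_ge0// lee_fin ltW.
  - apply: emeasurable_funD; first exact/measurable_EFinP.
    by apply: emeasurable_funM.
  - by apply: filterS HG => x Hx _.
rewrite ge0_integralD//; last 4 first.
- by move=> x _; rewrite lee_fin.
- exact/measurable_EFinP.
- by move=> x _; rewrite mule_ge0// lee_fin ltW.
- exact: emeasurable_funM.
rewrite ge0_integralZl//; last by rewrite lee_fin ltW.
rewrite leeD2l// lee_pmul2l//.
by apply: le_lower_integral.
Qed.

Lemma lower_integral_add1 (mu : probability T R) (b : T -> R) :
  (forall x, (0 <= b x)%R) ->
  \int[mu]_x (1 + b x)%:E <= 1 + \int[mu]_x (b x)%:E.
Proof.
move=> b0; rewrite ge0_integralTE => [|x]; last by rewrite lee_fin addr_ge0.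
apply: ge_ereal_sup => _ [h /= hb <-].
rewrite -integralT_nnsfun.
have := @integral_le_add_lower mu (EFin \o h) (cst 1%R) b 1.
rewrite (_ : \int[mu]_x (cst 1%R x)%:E = 1) ?mul1e; last first.
  by rewrite -[LHS]/(\int[mu]_x cst 1 x) integral_cst//= probability_setT mul1e.
apply => //.
- exact/measurable_EFinP.
- by move=> x; rewrite lee_fin.
- by apply: aeW => x; rewrite mul1r; exact: hb.
Qed.

End lower_integral.

Section pushforward.
Local Open Scope ereal_scope.
Context {d d' : measure_display} {T : measurableType d} {S : measurableType d'} {R : realType}.

(** Composing a simple function below [f] with [phi] gives one below [f \o phi];
    the inequality can be strict when [f] is not measurable. *)
Lemma le_integral_pushforward (mu : probability T R) (phi : T -> S) (f : S -> \bar R) :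
  measurable_fun setT phi -> (forall y, 0 <= f y) -> measurable_fun setT (f \o phi) ->
  \int[pushforward mu phi]_y f y <= \int[mu]_x f (phi x).
Proof.
move=> mphi f0 mf; rewrite ge0_integralTE//; apply: ge_ereal_sup => _ [h /= hf <-].
rewrite -integralT_nnsfun /=.
rewrite (ge0_integral_pushforward mphi)//=; last 2 first.
  exact/measurable_EFinP.
  by move=> y _; rewrite lee_fin.
rewrite preimage_setT; apply: ge0_le_integral => //.
- by move=> x _; rewrite lee_fin.
- by apply/measurable_EFinP; exact: measurableT_comp.
Qed.

End pushforward.

(** * Second moment of the standard Gaussian law *)

Section product.
Local Open Scope ereal_scope.
Context {d d' : measure_display} {T : measurableType d} {S : measurableType d'} {R : realType}.
Variables (P : probability T R) (Q : probability S R).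

Lemma integral_pprod (f : T * S -> \bar R) :
  measurable_fun setT f -> (forall z, 0 <= f z) ->
  \int[pprod P Q]_z f z = \int[P]_x \int[Q]_y f (x, y).
Proof. by move=> mf f0; exact: (@fubini_tonelli1 _ _ _ _ _ P Q). Qed.

Lemma measurable_fun_integral2 (f : T * S -> \bar R) :
  measurable_fun setT f -> (forall z, 0 <= f z) ->
  measurable_fun setT (fun x => \int[Q]_y f (x, y)).
Proof. by move=> mf f0; exact: (@measurable_fun_fubini_tonelli_F _ _ _ _ _ Q). Qed.

End product.

Section gaussian_moment.
Context {R : realType}.
Local Notation mu := (@lebesgue_measure R).

(** The Radon-Nikodym derivative of the normal law is its density. *)
Lemma integral_normal_prob (m s : R) (f : R -> \bar R) :
  measurable_fun setT f -> (forall x, 0 <= f x)%E ->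
  (\int[normal_prob m s]_x f x = \int[mu]_x (f x * (normal_pdf m s x)%:E))%E.
Proof.
move=> mf f0; have dom := @normal_prob_dominates R m s.
rewrite -(Radon_Nikodym_SigmaFinite.change_of_variables dom)//.
have mp := @measurable_normal_pdf R m s.
have ig := Radon_Nikodym_SigmaFinite.f_integrable dom.
apply: ae_eq_integral => //.
- by apply: emeasurable_funM => //; exact: measurable_int ig.
- by apply: emeasurable_funM => //; exact/measurable_EFinP.
- apply: ae_eqe_mul2l => /=.
  apply: integral_ae_eq => //=.
  + exact/measurable_EFinP.
  + move=> E _ mE.
    by rewrite -(Radon_Nikodym_SigmaFinite.f_integral dom).
Qed.

(** Since [1 + t <= expR t], [z^2] is at most [4 expR (z^2 / 4)], which turns
    the standard normal density into a multiple of the one of variance 2. *)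
Lemma normal_second_moment :
  (\int[normal_prob (0 : R) 1]_z (z ^+ 2)%:E <= 8%:E)%E.
Proof.
have s0 : Num.sqrt 2 != 0 :> R by rewrite gt_eqF// sqrtr_gt0.
rewrite integral_normal_prob; last 2 first.
- by apply/measurable_EFinP; exact: measurable_funX.
- by move=> x; rewrite lee_fin sqr_ge0.
apply: (@le_trans _ _ (\int[mu]_x (8%:E * (normal_pdf 0 (Num.sqrt 2) x)%:E))%E).
  apply: ge0_le_integral => //.
  - by move=> x _; rewrite -EFinM lee_fin mulr_ge0 ?sqr_ge0 ?normal_pdf_ge0.
  - apply: emeasurable_funM; apply/measurable_EFinP; first exact: measurable_funX.
    exact: measurable_normal_pdf.
  - apply: emeasurable_funM => //; apply/measurable_EFinP.
    exact: measurable_normal_pdf.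
  - move=> x _; rewrite -!EFinM lee_fin !normal_pdfE ?oner_eq0//.
    rewrite /normal_peak /normal_fun !subr0 expr1n sqr_sqrtr// mul1r.
    set t := x ^+ 2 / 4.
    have -> : - x ^+ 2 / 2 = - t - t by rewrite /t; field.
    have -> : - x ^+ 2 / (2 *+ 2) = - t by rewrite /t; field.
    rewrite expRD.
    have x2 : x ^+ 2 <= 4 * expR t.
      have := expR_ge1Dx t.
      have -> : x ^+ 2 = 4 * t by rewrite /t; field.
      lra.
    have p0 : 0 < pi *+ 2 :> R by rewrite mulrn_wgt0// pi_gt0.
    have q0 : 0 < 2 * pi *+ 2 :> R by rewrite mulrn_wgt0// mulr_gt0// pi_gt0.
    have pk : (Num.sqrt (pi *+ 2))^-1 <= 2 * (Num.sqrt (2 * pi *+ 2))^-1 :> R.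
      rewrite ler_pdivlMr ?sqrtr_gt0// mulrC ler_pdivrMr ?sqrtr_gt0//.
      have -> : 2 * Num.sqrt (pi *+ 2) = Num.sqrt (2 ^+ 2 * (pi *+ 2)) :> R.
        by rewrite sqrtrM ?sqr_ge0// sqrtr_sqr ger0_norm.
      by rewrite ler_wsqrtr//; move: p0; lra.
    have et : x ^+ 2 * expR (- t) <= 4.
      by rewrite expRN ler_pdivrMr ?expR_gt0.
    rewrite (_ : x ^+ 2 * _ = (x ^+ 2 * expR (- t)) *
      ((Num.sqrt (pi *+ 2))^-1 * expR (- t))); last by ring.
    rewrite (_ : 8 * _ = 4 * (2 * (Num.sqrt (2 * pi *+ 2))^-1 * expR (- t))); last by ring.
    apply: ler_pM => //.
    + by rewrite mulr_ge0 ?sqr_ge0 ?expR_ge0.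
    + by rewrite ler_wpM2r ?expR_ge0.
rewrite ge0_integralZl//; last 2 first.
- by apply/measurable_EFinP; exact: measurable_normal_pdf.
- by move=> x _; rewrite lee_fin normal_pdf_ge0.
by rewrite integral_normal_pdf mule1.
Qed.

Lemma gauss_second_moment n :
  (\int[std_gauss n]_g (dot g g)%:E <= (8 * n%:R : R)%:E)%E.
Proof.
elim: n => [|n IH].
  rewrite mulr0 (_ : (fun g => _) = cst 0%E) ?integral0//.
  by apply/funext => g; rewrite dotE big_ord0.
have mdot k : measurable_fun setT (fun g : 'cV[R]_k => dot g g).
  under eq_fun do rewrite -sqr_enorm.
  by apply: measurable_funX; exact: measurable_enorm.
rewrite /=.
rewrite ge0_integral_pushforward//=; last 2 first.
- by apply/measurable_EFinP; exact: mdot.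
- by move=> g _; rewrite lee_fin dot_ge0.
rewrite preimage_setT.
rewrite (_ : (fun x => _) = fun p : measurableTypeR R * 'cV[R]_n =>
  (p.1 ^+ 2 + dot p.2 p.2)%:E); last first.
  apply/funext => p /=; congr EFin; rewrite /dot /cons_cV.
  rewrite (@tr_col_mx _ 1 n 1) (@mul_row_col _ 1 1 n 1) mxE; congr (_ + _).
  by rewrite mxE big_ord1 !mxE expr2.
have m1 : measurable_fun setT (fun p : measurableTypeR R * 'cV[R]_n => p.1 ^+ 2).
  by apply: measurable_funX; exact: measurable_fst.
have m2 : measurable_fun setT (fun p : measurableTypeR R * 'cV[R]_n => dot p.2 p.2).
  by apply: (measurableT_comp (mdot n)); exact: measurable_snd.
rewrite integral_pprod; last 2 first.
- by apply/measurable_EFinP; exact: measurable_funD.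
- by move=> p; rewrite lee_fin addr_ge0 ?sqr_ge0 ?dot_ge0.
apply: (@le_trans _ _ (\int[normal_prob (0 : R) 1]_z ((z ^+ 2)%:E + (8 * n%:R)%:E))%E).
  apply: ge0_le_integral => //.
  - by move=> z _; apply: integral_ge0 => g _; rewrite lee_fin addr_ge0 ?sqr_ge0 ?dot_ge0.
  - apply: (@measurable_fun_integral2 _ _ _ _ _ (std_gauss n)
      (fun p : measurableTypeR R * 'cV[R]_n => (p.1 ^+ 2 + dot p.2 p.2)%:E)).
      by apply/measurable_EFinP; exact: measurable_funD.
    by move=> p; rewrite lee_fin addr_ge0 ?sqr_ge0 ?dot_ge0.
  - by apply/measurable_EFinP; apply: measurable_funD => //; exact: measurable_funX.
  - move=> z _ /=; under eq_integral do rewrite EFinD.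
    rewrite ge0_integralD//; last 3 first.
    + by move=> g _; rewrite lee_fin sqr_ge0.
    + by move=> g _; rewrite lee_fin dot_ge0.
    + by apply/measurable_EFinP; exact: mdot.
    by rewrite integral_cst//= probability_setT mule1 leeD2l.
rewrite ge0_integralD//; last 2 first.
- by move=> z _; rewrite lee_fin sqr_ge0.
- by apply/measurable_EFinP; exact: measurable_funX.
rewrite integral_cst//= probability_setT mule1.
rewrite -[n.+1%:R]natr1 mulrDr mulr1 EFinD [leRHS]addeC leeD2r//.
exact: normal_second_moment.
Qed.

End gaussian_moment.

(** * Couplings and products of kernels *)

Section coupling.
Local Open Scope ereal_scope.
Context {d d' : measure_display} {W : measurableType d} {T : measurableType d'}.
Context {R : realType}.

Lemma poweR_half_sqr (x : \bar R) : 0 <= x -> (x `^ 2^-1) ^+ 2 = x.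
Proof.
case: x => [r| |]//; last by rewrite /= invr_eq0 pnatr_eq0.
rewrite lee_fin => r0; by rewrite poweR_EFin -EFin_expe powR12_sqrt// sqr_sqrtr.
Qed.

Lemma W2_ge0 (rho : T -> T -> R) (eta1 eta2 : set T -> \bar R) :
  0 <= W2 rho eta1 eta2.
Proof. by apply: le_ereal_inf_tmp => _ [pi _ <-]; exact: poweR_ge0. Qed.

(** The joint law of [X] and [Y] is a coupling. *)
Lemma W2_le_coupling (Q : probability W R) (X Y : W -> T) (rho : T -> T -> R)
    (eta1 eta2 : set T -> \bar R) :
  measurable_fun setT X -> measurable_fun setT Y ->
  (forall A, measurable A -> eta1 A = Q (X @^-1` A)) ->
  (forall A, measurable A -> eta2 A = Q (Y @^-1` A)) ->
  measurable_fun setT (fun w => rho (X w) (Y w)) ->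
  W2 rho eta1 eta2 ^+ 2 <= \int[Q]_w (rho (X w) (Y w) ^+ 2)%:E.
Proof.
move=> mX mY etaX etaY mrho; pose phi0 w := (X w, Y w).
have mphi : measurable_fun setT phi0 by exact: measurable_fun_pair.
pose phi : {mfun W >-> (T * T)%type} :=
  HB.pack phi0 (isMeasurableFun.Build _ _ _ _ phi0 mphi).
pose pi : probability (T * T)%type R := distribution Q phi.
have cpi : couplings eta1 eta2 pi.
  move=> A mA; rewrite etaX// etaY//; split; congr (Q _).
    by apply/seteqP; split=> w /= => [[]|].
  by apply/seteqP; split=> w /= => [[]|].
apply: (@le_trans _ _ (\int[pi]_z (rho z.1 z.2 ^+ 2)%:E)).
  rewrite -[leRHS]poweR_half_sqr; last first.
    by apply: integral_ge0 => z _; rewrite lee_fin sqr_ge0.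
  rewrite lee_sqr ?W2_ge0 ?poweR_ge0//.
  by apply: ereal_inf_lbound; exists pi.
refine (@le_integral_pushforward _ _ _ (T * T)%type _ Q phi0
  (fun z => (rho z.1 z.2 ^+ 2)%:E) mphi _ _).
  by move=> z; rewrite lee_fin sqr_ge0.
by apply/measurable_EFinP; exact: measurable_funX.
Qed.

End coupling.

Section kernel_product.
Local Open Scope ereal_scope.
Context {d d' d'' : measure_display}.
Context {X : measurableType d} {Y : measurableType d'} {Z : measurableType d''}.
Context {R : realType}.

(** A kernel driven by an independent noise [g] turns [kprod] into an image of
    a product measure; no measurability is involved. *)
Lemma kprod_noise (mu : probability X R) (g : probability Z R) (F : X -> Z -> Y)
    (K : X -> set Y -> \bar R) A :
  (forall x B, K x B = g (F x @^-1` B)) ->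
  kprod mu K A = pprod mu g ((fun p => (p.1, F p.1 p.2)) @^-1` A).
Proof.
move=> KF; rewrite /kprod; apply: eq_integral => x _.
by rewrite KF.
Qed.

End kernel_product.

Section model.
Local Open Scope ereal_scope.
Context {R : realType} {d : nat} {U V : pmetricType R}.
Variables (iota : probability (borel U) R) (jota : probability (borel V) R).
Variables (m : borel U -> 'cV[R]_d) (s : borel U -> 'M[R]_d).
Variables (n : borel V -> 'cV[R]_d) (chi : 'M[R]_d).
Variable kap : borel U -> borel V -> 'M[R]_d.

Local Notation G := (@std_gauss R d).

(** [source] samples the first marginal and [target] the transition from a
    Gaussian noise in the second component. *)
Definition source (p : borel U * 'cV[R]_d) : borel U * 'cV[R]_d :=
  (p.1, affine (m p.1) (sqrtm (s p.1)) p.2).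

Definition target (p : borel U * 'cV[R]_d) (q : borel V * 'cV[R]_d) :
    borel V * 'cV[R]_d :=
  (q.1, affine (n q.1 + kap p.1 q.1 *m chi *m (p.2 - m p.1))%R
               (sqrtm (kap p.1 q.1)) q.2).

Definition noise : probability ((borel U * 'cV[R]_d) * (borel V * 'cV[R]_d))%type R :=
  pprod (pprod iota G) (pprod jota G).

Definition model (w : (borel U * 'cV[R]_d) * (borel V * 'cV[R]_d)) :=
  (source w.1, target (source w.1) w.2).

Hypotheses (ms : measurable_fun setT source)
  (mt : measurable_fun setT (fun w => target w.1 w.2)).

Lemma kprod_model A : measurable A ->
  kprod (marginal iota m s) (transition jota chi m n kap) A
  = noise (model @^-1` A).
Proof.
move=> mA.
pose src : {mfun (borel U * 'cV[R]_d)%type >-> (borel U * 'cV[R]_d)%type} :=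
  HB.pack source (isMeasurableFun.Build _ _ _ _ source ms).
have -> : marginal iota m s = distribution (pprod iota G) src.
  by apply/funext => B; 
    exact: (@kprod_noise _ _ _ _ _ _ _ iota G (fun u g => affine (m u) (sqrtm (s u)) g)).
have tE p B : transition jota chi m n kap p B = pprod jota G (target p @^-1` B).
  exact: (@kprod_noise _ _ _ _ _ _ _ jota G (fun v g =>
    affine (n v + kap p.1 v *m chi *m (p.2 - m p.1))%R (sqrtm (kap p.1 v)) g)).
rewrite (@kprod_noise _ _ _ _ _ _ _ (distribution (pprod iota G) src)
  (pprod jota G) target _ _ tE).
set B := (fun p => _) @^-1` A.
have mB : measurable B.
  rewrite -[B]setTI; apply: (measurable_fun_pair measurable_fst mt) => //.
rewrite [LHS]/(\int[pushforward (pprod iota G) source]_p pprod jota G (xsection B p)).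
have mBx : measurable_fun setT (fun p => pprod jota G (xsection B p)).
  exact: (@measurable_fun_xsection _ _ _ _ _ (pprod jota G)).
transitivity (\int[pprod iota G]_(w in source @^-1` setT) pprod jota G (xsection B (source w))).
  by apply: (@ge0_integral_pushforward _ _ _ _ R source ms (pprod iota G) setT
    (fun p => pprod jota G (xsection B p))).
by rewrite preimage_setT; apply: eq_integral => w _.
Qed.

End model.

(** * Integrating the transport cost over the shared noise *)

Section fourfold.
Local Open Scope ereal_scope.
Context {d1 d2 d3 d4 : measure_display} {R : realType}.
Context {T1 : measurableType d1} {T2 : measurableType d2}.
Context {T3 : measurableType d3} {T4 : measurableType d4}.
Variables (P1 : probability T1 R) (P2 : probability T2 R).
Variables (P3 : probability T3 R) (P4 : probability T4 R).
Variable c : ((T1 * T2) * (T3 * T4))%type -> \bar R.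
Hypotheses (mc : measurable_fun setT c) (c0 : forall w, 0 <= c w).

Let mc2 : measurable_fun setT
  (fun y : ((T1 * T3) * (T2 * T4))%type => c ((y.1.1, y.2.1), (y.1.2, y.2.2))).
Proof.
apply: (measurableT_comp mc); apply: measurable_fun_pair; apply: measurable_fun_pair.
- exact: measurableT_comp measurable_fst measurable_fst.
- exact: measurableT_comp measurable_fst measurable_snd.
- exact: measurableT_comp measurable_snd measurable_fst.
- exact: measurableT_comp measurable_snd measurable_snd.
Qed.

Lemma measurable_inner_integral : measurable_fun setT
  (fun y : (T1 * T3)%type => \int[pprod P2 P4]_z c ((y.1, z.1), (y.2, z.2))).
Proof.
exact: (@measurable_fun_integral2 _ _ _ _ _ (pprod P2 P4)
  (fun y : ((T1 * T3) * (T2 * T4))%type => c ((y.1.1, y.2.1), (y.1.2, y.2.2)))).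
Qed.

(** Tonelli, moving the two noise variables inside. *)
Lemma integral_pprod4 :
  \int[pprod (pprod P1 P2) (pprod P3 P4)]_w c w =
  \int[P1]_x \int[P3]_y \int[pprod P2 P4]_z c ((x, z.1), (y, z.2)).
Proof.
rewrite integral_pprod//.
rewrite integral_pprod; last 2 first.
- exact: measurable_fun_integral2.
- by move=> p; exact: integral_ge0.
apply: eq_integral => x _.
have mx : measurable_fun setT
    (fun p : ((T2 * T3) * T4)%type => c ((x, p.1.1), (p.1.2, p.2))).
  apply: (measurableT_comp mc); apply: measurable_fun_pair; apply: measurable_fun_pair => //.
  - exact: measurableT_comp measurable_fst measurable_fst.
  - exact: measurableT_comp measurable_snd measurable_fst.
transitivity (\int[P2]_y \int[P3]_z \int[P4]_t c ((x, y), (z, t))).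
  apply: eq_integral => y _; rewrite integral_pprod//.
  by apply: (measurableT_comp mc); apply: measurable_fun_pair.
rewrite (@fubini_tonelli _ _ _ _ _ P2 P3
  (fun p => \int[P4]_t c ((x, p.1), (p.2, t)))).
- apply: eq_integral => y _; rewrite integral_pprod//=.
  apply: (measurableT_comp mc); apply: measurable_fun_pair; apply: measurable_fun_pair => //.
- exact: (@measurable_fun_integral2 _ _ _ _ _ P4
    (fun p : ((T2 * T3) * T4)%type => c ((x, p.1.1), (p.1.2, p.2)))).
- by move=> p; exact: integral_ge0.
Qed.

End fourfold.

Section integral_cost.
Local Open Scope ereal_scope.
Context {R : realType} {n : nat} {d1 d2 : measure_display}.
Context {T1 : measurableType d1} {T2 : measurableType d2}.
Local Notation G := (@std_gauss R n).

Lemma measurable_dot {dT : measure_display} {T : measurableType dT} (f : T -> 'cV[R]_n) :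
  measurable_fun setT f -> measurable_fun setT (fun t => dot (f t) (f t)).
Proof.
move=> mf; under eq_fun do rewrite -sqr_enorm.
by apply: measurable_funX; exact: measurable_enorm.
Qed.

Lemma integral_gauss_pair (A B : R) : (0 <= A)%R -> (0 <= B)%R ->
  \int[pprod G G]_z (A + B * (dot z.1 z.1 + dot z.2 z.2))%:E
  <= (A + 16 * n%:R * B)%:E.
Proof.
move=> A0 B0.
have m1 := @measurable_dot _ _ _ (@measurable_id _ 'cV[R]_n setT).
have gd k (g : 'cV[R]_k) : (0 <= dot g g)%R := dot_ge0 g.
rewrite integral_pprod; last 2 first.
- apply/measurable_EFinP; apply: measurable_funD => //; apply: measurable_funM => //.
  apply: measurable_funD; apply: measurable_dot;
    [exact: measurable_fst|exact: measurable_snd].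
- by move=> z; rewrite lee_fin !(addr_ge0, mulr_ge0).
have bnd (a : R) : (0 <= a)%R ->
    \int[G]_g (a + B * dot g g)%:E <= (a + 8 * n%:R * B)%:E.
  move=> a0; under eq_integral do rewrite EFinD EFinM.
  rewrite ge0_integralD//; last 2 first.
  - by move=> g _; rewrite mule_ge0// lee_fin.
  - by apply: emeasurable_funM => //; exact/measurable_EFinP.
  rewrite ge0_integralZl//; last 2 first.
  - exact/measurable_EFinP.
  - by move=> g _; rewrite lee_fin.
  rewrite integral_cst//= probability_setT mule1 EFinD leeD2l//.
  rewrite [X in _ <= X%:E]mulrC EFinM lee_wpmul2l ?lee_fin//.
  exact: gauss_second_moment.
apply: (@le_trans _ _ (\int[G]_x ((A + 8 * n%:R * B) + B * dot x x)%:E)).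
  apply: le_lower_integral => x.
    by apply: integral_ge0 => y _; rewrite lee_fin !(addr_ge0, mulr_ge0).
  have := bnd (A + B * dot x x)%R; rewrite addr_ge0 ?mulr_ge0// => /(_ isT).
  under eq_integral do rewrite -addrA -mulrDr.
  by rewrite addrAC.
apply: (le_trans (bnd _ _)); first by rewrite addr_ge0// !mulr_ge0.
by rewrite lee_fin -addrA lerD2l; lra.
Qed.

Variables (P1 : probability T1 R) (P2 : probability T2 R).
Variable cost : ((T1 * 'cV[R]_n) * (T2 * 'cV[R]_n))%type -> R.
Variables (pm q : T1 -> R) (pn w : T2 -> R) (K : R).
Hypotheses (n0 : (0 < n)%N) (mcost : measurable_fun setT cost).
Hypotheses (cost0 : forall z, (0 <= cost z)%R).
Hypotheses (mpm : measurable_fun setT pm) (mq : measurable_fun setT q).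
Hypothesis mpn : measurable_fun setT pn.
Hypotheses (pm0 : forall u, (0 <= pm u)%R) (q0 : forall u, (0 <= q u)%R).
Hypotheses (pn0 : forall v, (0 <= pn v)%R) (w0 : forall v, (0 <= w v)%R).
Hypothesis K0 : (0 < K)%R.
Hypothesis le_cost : {ae P1, forall u, {ae P2, forall v, forall g h,
  (cost ((u, g), (v, h)) <=
   3 * (pm u + pn v + K * (q u + w v) * (dot g g + dot h h)))%R}}.

(** Integrating the noises first turns the pointwise bound into one on [u] and
    [v] alone, where [w] may fail to be measurable. *)
Lemma integral_cost :
  \int[pprod (pprod P1 G) (pprod P2 G)]_z (cost z)%:E <=
  3%:E * (\int[P1]_u (pm u)%:E + \int[P2]_v (pn v)%:E) +
  (48 * n%:R * K)%:E * (\int[P1]_u (q u)%:E + \int[P2]_v (w v)%:E).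
Proof.
have mc : measurable_fun setT (EFin \o cost) by exact/measurable_EFinP.
have c0 z : 0 <= (EFin \o cost) z by rewrite lee_fin.
rewrite (integral_pprod4 P1 G P2 G mc c0).
have mH := measurable_inner_integral G G mc c0.
set H := (fun y => _) in mH.
have H0 y : 0 <= H y by apply: integral_ge0 => z _; exact: c0.
pose L := (48 * n%:R * K)%R.
have L0 : (0 < L)%R by rewrite !mulr_gt0// ltr0n.
pose E2 := 3%:E * \int[P2]_v (pn v)%:E + L%:E * \int[P2]_v (w v)%:E.
have E20 : 0 <= E2.
  by rewrite adde_ge0// mule_ge0 ?lee_fin ?(ltW L0)// integral_ge0// => v _; rewrite lee_fin.
have inner : {ae P1, forall u, \int[P2]_v H (u, v) <= (3 * pm u + L * q u)%:E + E2}.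
  apply: filterS le_cost => u le_u.
  have f0 v : (0 <= 3 * pm u + L * q u + 3 * pn v)%R.
    by rewrite !addr_ge0// mulr_ge0// ltW.
  have mHu : measurable_fun setT (fun v => H (u, v)).
    by apply: (measurableT_comp mH); exact: pair1_measurable.
  have mf : measurable_fun setT (fun v => 3 * pm u + L * q u + 3 * pn v)%R.
    by apply: measurable_funD => //; exact: measurable_funM.
  apply: (@le_trans _ _ (\int[P2]_v (3 * pm u + L * q u + 3 * pn v)%:E +
      L%:E * \int[P2]_v (w v)%:E)).
    apply: integral_le_add_lower => //.
    apply: filterS le_u => v le_uv.
    apply: (@le_trans _ _ (\int[pprod G G]_z (3 * (pm u + pn v) +
        3 * K * (q u + w v) * (dot z.1 z.1 + dot z.2 z.2))%:E)).
      apply: le_lower_integral => z; first exact: c0.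
      rewrite lee_fin; apply: (le_trans (le_uv _ _)); rewrite le_eqVlt; apply/orP; left.
      by apply/eqP; ring.
    apply: (le_trans (integral_gauss_pair _ _)).
    - by rewrite mulr_ge0// addr_ge0.
    - by rewrite mulr_ge0 ?addr_ge0// mulr_ge0// ltW.
    - by rewrite lee_fin /L le_eqVlt; apply/orP; left; apply/eqP; ring.
  rewrite /E2 addeA leeD2r//.
  under eq_integral do rewrite EFinD EFinM.
  rewrite ge0_integralD//; last 3 first.
  - by move=> v _; rewrite lee_fin addr_ge0// mulr_ge0// ltW.
  - by move=> v _; rewrite mule_ge0// lee_fin.
  - by apply: emeasurable_funM => //; exact/measurable_EFinP.
  rewrite integral_cst//= probability_setT mule1 ge0_integralZl//.
  - exact/measurable_EFinP.
  - by move=> v _; rewrite lee_fin.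
have pq0 u : (0 <= 3 * pm u + L * q u)%R.
  by apply: addr_ge0; apply: mulr_ge0 => //; exact: ltW.
have mout : measurable_fun setT (fun u => \int[P2]_v H (u, v)).
  exact: measurable_fun_integral2.
apply: (@le_trans _ _ (\int[P1]_u ((3 * pm u + L * q u)%:E + E2))).
  apply: ae_ge0_le_integral => //.
  - by move=> u _; apply: integral_ge0 => y _; exact: (H0 (u, y)).
  - by move=> u _; apply: adde_ge0 => //; rewrite lee_fin.
  - apply: emeasurable_funD => //; apply/measurable_EFinP.
    by apply: measurable_funD; apply: measurable_funM.
  - by apply: filterS inner => u h _.
have mEpm : measurable_fun setT (fun u => (pm u)%:E) by exact/measurable_EFinP.
have mEq : measurable_fun setT (fun u => (q u)%:E) by exact/measurable_EFinP.
rewrite ge0_integralD//; last 2 first.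
- by move=> u _; rewrite lee_fin.
- by apply/measurable_EFinP; apply: measurable_funD; apply: measurable_funM.
rewrite integral_cst//= probability_setT mule1.
under eq_integral do rewrite EFinD EFinM (EFinM L).
rewrite ge0_integralD//; last 4 first.
- by move=> u _; rewrite mule_ge0// lee_fin.
- exact: emeasurable_funM.
- by move=> u _; rewrite mule_ge0// lee_fin// ltW.
- exact: emeasurable_funM.
rewrite ge0_integralZl//; last by move=> u _; rewrite lee_fin.
rewrite ge0_integralZl//; last 2 first.
- by move=> u _; rewrite lee_fin.
- by rewrite lee_fin ltW.
have i0 (dT : measure_display) (T : measurableType dT) (P : probability T R) (f : T -> R) :
    (forall t, 0 <= f t)%R -> 0 <= \int[P]_t (f t)%:E.
  by move=> f0; apply: integral_ge0 => t _; rewrite lee_fin.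
rewrite -/L /E2.
move: (i0 _ _ P1 _ pm0) (i0 _ _ P1 _ q0) (i0 _ _ P2 _ pn0) (i0 _ _ P2 _ w0).
move: (\int[P1]_u (pm u)%:E) (\int[P1]_u (q u)%:E).
move: (\int[P2]_v (pn v)%:E) (\int[P2]_v (w v)%:E) => b e a f a0 f0 b0 e0.
by rewrite !ge0_muleDr// addeACA.
Qed.

End integral_cost.

(** * The two models as images of the same noise *)

Section measurable_model.
Context {R : realType} {d : nat} {U V : pmetricType R}.
Variables (m : borel U -> 'cV[R]_d) (s : borel U -> 'M[R]_d).
Variables (n : borel V -> 'cV[R]_d) (vs : borel V -> 'M[R]_d).
Variables (chi : 'M[R]_d) (e : R).
Hypotheses (mm : measurable_fun setT m) (ms : measurable_fun setT s).
Hypotheses (mn : measurable_fun setT n) (mv : measurable_fun setT vs).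
Hypotheses (e0 : 0 <= e) (ps : forall u, psd (s u)) (pv : forall v, psd (vs v)).

Let kap u v := bridge_cov chi e (s u) (vs v).

Lemma measurable_source : measurable_fun setT (source m s).
Proof.
apply: measurable_fun_pair; first exact: measurable_fst.
apply: measurable_addmx; first exact: measurableT_comp mm measurable_fst.
apply: measurable_mulmx; last exact: measurable_snd.
apply: measurable_sqrtm => //; exact: measurableT_comp ms measurable_fst.
Qed.

Lemma measurable_target :
  measurable_fun setT (fun w => target m n chi kap w.1 w.2).
Proof.
pose W := ((borel U * 'cV[R]_d) * (borel V * 'cV[R]_d))%type.
have m11 : measurable_fun setT (fun w : W => w.1.1).
  exact: measurableT_comp measurable_fst measurable_fst.
have m12 : measurable_fun setT (fun w : W => w.1.2).
  exact: measurableT_comp measurable_snd measurable_fst.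
have m21 : measurable_fun setT (fun w : W => w.2.1).
  exact: measurableT_comp measurable_fst measurable_snd.
have m22 : measurable_fun setT (fun w : W => w.2.2).
  exact: measurableT_comp measurable_snd measurable_snd.
have mk : measurable_fun setT (fun w : W => kap w.1.1 w.2.1).
  by apply: measurable_bridge_cov => //; apply: measurableT_comp.
apply: measurable_fun_pair => //; apply: measurable_addmx.
  apply: measurable_addmx; first exact: measurableT_comp mn m21.
  apply: measurable_mulmx; first exact: measurable_mulmx.
  by apply: measurable_submx => //; exact: measurableT_comp mm m11.
apply: measurable_mulmx => //; apply: measurable_sqrtm => // w.
exact: psd_bridge_cov.
Qed.

Lemma measurable_model : measurable_fun setT (model m s n chi kap).
Proof.
have m1 : measurable_fun setT
    (fun w : (borel U * 'cV[R]_d) * (borel V * 'cV[R]_d) => source m s w.1).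
  exact: measurableT_comp measurable_source measurable_fst.
apply: measurable_fun_pair => //.
exact: (measurableT_comp measurable_target (measurable_fun_pair m1 measurable_snd)).
Qed.

End measurable_model.

Section cost.
Context {R : realType} {d : nat} {U V : pmetricType R}.

(** Points of the metric spaces are shared, so only the Euclidean parts differ. *)
Lemma rho_joint_diag (p q : (borel U * 'cV[R]_d) * (borel V * 'cV[R]_d)) :
  p.1.1 = q.1.1 -> p.2.1 = q.2.1 ->
  rho_joint p q = Num.sqrt (enorm (p.1.2 - q.1.2) ^+ 2 + enorm (p.2.2 - q.2.2) ^+ 2).
Proof.
move=> e1 e2; rewrite /rho_joint /rho_aug e1 e2 !mdistxx expr0n/= !add0r.
move: (enorm _) (enorm _) => x y.
by rewrite !sqr_sqrtr ?sqr_ge0.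
Qed.

Variables (m mh : borel U -> 'cV[R]_d) (s sh : borel U -> 'M[R]_d).
Variables (n nh : borel V -> 'cV[R]_d) (vs vsh : borel V -> 'M[R]_d).
Variables (chi : 'M[R]_d) (e : R).

Let K u v := bridge_cov chi 0 (s u) (vs v).
Let Kh u v := bridge_cov chi e (sh u) (vsh v).

Lemma rho_joint_model u g v h :
  rho_joint (model mh sh nh chi Kh ((u, g), (v, h)))
            (model m s n chi K ((u, g), (v, h))) ^+ 2 =
  cost_vec chi e (s u) (vs v) (sh u) (vsh v) (mh u - m u) (nh v - n v) g h.
Proof.
have aff (k : nat) (a b : 'cV[R]_k) A B x :
    affine a A x - affine b B x = (a - b) + (A - B) *m x.
  by rewrite /affine mulmxBl opprD addrACA.
have affK (k : nat) (a : 'cV[R]_k) A x : affine a A x - a = A *m x.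
  by rewrite /affine addrAC subrr add0r.
rewrite rho_joint_diag// sqr_sqrtr ?addr_ge0 ?sqr_ge0// /cost_vec.
rewrite [X in enorm X ^+ 2 + _]aff [X in _ + enorm X ^+ 2]aff /=.
by rewrite !affK !mulmxA opprD addrACA -mulmxBl.
Qed.

End cost.

Section moments.
Local Open Scope ereal_scope.
Context {R : realType}.

Lemma moment_ge0 {d} {T : measurableType d} (mu : probability T R) (f : T -> R) k :
  (forall t, 0 <= f t)%R -> 0 <= moment mu f k.
Proof. by move=> f0; apply: integral_ge0 => t _; rewrite lee_fin exprn_ge0. Qed.

Lemma le_Bmax_s (bs bv : nat -> \bar R) : bs 1%N <= Bmax bs bv.
Proof. by rewrite /Bmax !big_cons !le_max lexx ?orbT. Qed.

Lemma le_Bmax_v (bs bv : nat -> \bar R) : bv 1%N <= Bmax bs bv.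
Proof. by rewrite /Bmax !big_cons !le_max lexx ?orbT. Qed.

(** Estimates of small mean norm cannot be close to matrices bounded below:
    [Cl <= w + f <= w + f^2 / Cl + Cl / 4]. *)
Lemma moment2_lower_bound {d} {T : measurableType d} (mu : probability T R)
    (f w : T -> R) (c : R) :
  measurable_fun setT f -> (forall t, 0 <= f t)%R -> (forall t, 0 <= w t)%R ->
  (0 < c)%R -> {ae mu, forall t, (c <= w t + f t)%R} ->
  moment mu w 1%N <= (c / 2)%:E -> (c ^+ 2 / 4)%:E <= moment mu f 2%N.
Proof.
move=> mf f0 w0 c0 cwf wc.
have i0 : (0 <= c^-1)%R by rewrite invr_ge0 ltW.
have h : \int[mu]_t (cst (c * 3 / 4)%:E t) <=
    \int[mu]_t (c^-1 * f t ^+ 2)%:E + 1%:E * \int[mu]_t (w t ^+ 1)%:E.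
  apply: integral_le_add_lower => //.
  - by move=> t; rewrite lee_fin divr_ge0// mulr_ge0// ltW.
  - by apply: measurable_funM => //; exact: measurable_funX.
  - by move=> t; rewrite mulr_ge0 ?sqr_ge0.
  - apply: filterS cwf => t ct; rewrite lee_fin mul1r expr1.
    have : (0 <= c^-1 * (f t - c / 2) ^+ 2)%R by rewrite mulr_ge0 ?sqr_ge0.
    have -> : (c^-1 * (f t - c / 2) ^+ 2 = c^-1 * f t ^+ 2 - f t + c / 4)%R.
      by field; rewrite gt_eqF.
    by move: ct; lra.
move: h; rewrite integral_cst//= probability_setT mule1 mul1e.
under [X in _ <= X + _ -> _]eq_integral do rewrite EFinM.
rewrite ge0_integralZl//; last 2 first.
- by apply/measurable_EFinP; exact: measurable_funX.
- by move=> t _; rewrite lee_fin sqr_ge0.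
rewrite -/(moment mu f 2) -/(moment mu w 1) => h.
have := moment_ge0 mu 2 f0; move: (moment mu f 2) h => [r| |] h r0; [|by rewrite leey|by []].
have {h} := le_trans h (leeD2l _ wc).
rewrite -EFinM -EFinD !lee_fin => h.
have : (c * (c / 4) <= c * (c^-1 * r))%R by rewrite ler_pM2l//; lra.
by rewrite (mulrA c c^-1%R) divff ?gt_eqF// mul1r; lra.
Qed.

End moments.

(** * The Wasserstein bound *)

Section assembly.
Local Open Scope ereal_scope.
Context {R : realType} {d : nat} {U V : pmetricType R}.
Variables (iota : probability (borel U) R) (jota : probability (borel V) R).
Variables (m mh : borel U -> 'cV[R]_d) (s sh : borel U -> 'M[R]_d).
Variables (n nh : borel V -> 'cV[R]_d) (vs vsh : borel V -> 'M[R]_d).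
Variables (chi : 'M[R]_d) (eps Cl Cu : R).
Hypotheses (d0 : (0 < d)%N).
Hypotheses (mm : measurable_fun setT m) (mmh : measurable_fun setT mh).
Hypotheses (ms : measurable_fun setT s) (msh : measurable_fun setT sh).
Hypotheses (mn : measurable_fun setT n) (mnh : measurable_fun setT nh).
Hypotheses (mv : measurable_fun setT vs) (mvh : measurable_fun setT vsh).
Hypotheses (ps : forall u, spd (s u)) (psh : forall u, psd (sh u)).
Hypotheses (pv : forall v, spd (vs v)) (pvh : forall v, psd (vsh v)).
Hypotheses (eps0 : (0 < eps)%R) (Cl0 : (0 < Cl)%R) (ClCu : (Cl <= Cu)%R).
Hypothesis spd_chi : spd (chi *m chi^T)%R.
Hypothesis good : {ae iota, forall u, {ae jota, forall v,
  (Cl <= Num.min (lambda_min (s u)) (lambda_min (vs v)))%R /\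
  (Num.max (opnorm (s u)) (opnorm (vs v)) <= Cu)%R}}.

Let P := marginal iota m s.
Let Ph := marginal iota mh sh.
Let M := transition jota chi m n (fun u v => kappa chi (s u) (vs v)).
Let Mh := transition jota chi mh nh (fun u v => kappa_eps chi eps (sh u) (vsh v)).
Let Dm := moment iota (fun u => enorm (mh u - m u)%R).
Let Dn := moment jota (fun v => enorm (nh v - n v)%R).
Let Ds := moment iota (fun u => normF (sh u - s u)%R).
Let Dv := moment jota (fun v => normF (vsh v - vs v)%R).
Let bs := moment iota (fun u => opnorm (sh u)).
Let bv := moment jota (fun v => opnorm (vsh v)).
Let k := opnorm chi.
Let cost u v := cost_vec chi eps (s u) (vs v) (sh u) (vsh v).

Let Cu0 : (0 <= Cu)%R.
Proof. exact: le_trans (ltW Cl0) ClCu. Qed.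

Let Cfine_gt0 : (0 < Cfine Cl Cu k)%R.
Proof.
rewrite /Cfine; have := sqr_ge0 (Cbridge Cl Cu k).
have : (0 <= Cl^-1)%R by rewrite invr_ge0 ltW.
by move: Cu0; lra.
Qed.

(** The coupling shares the points [u], [v] and both Gaussian noises. The
    function [w] is [dv^2 + eps^2] for the fine bound and [1 + |vsh|] for the
    crude one. *)
Lemma W2_le_cost (K : R) (w : V -> R) : (0 < K)%R -> (forall v, 0 <= w v)%R ->
  (forall u v, psd (s u) -> psd (vs v) -> lowb (s u) Cl -> lowb (vs v) Cl ->
     opb (s u) Cu -> opb (vs v) Cu -> forall a b g h,
     (cost u v a b g h <= 3 * (enorm a ^+ 2 + enorm b ^+ 2 +
       K * (normF (sh u - s u) ^+ 2 + w v) * (dot g g + dot h h)))%R) ->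
  W2 rho_joint (kprod Ph Mh) (kprod P M) ^+ 2 <=
  3%:E * (Dm 2%N + Dn 2%N) + (48 * d%:R * K)%:E * (Ds 2%N + \int[jota]_v (w v)%:E).
Proof.
move=> K0 w0 le_cost.
have pps u := spd_psd (ps u); have ppv v := spd_psd (pv v).
have kE : (fun u v => kappa chi (s u) (vs v)) = (fun u v => bridge_cov chi 0 (s u) (vs v)).
  by apply/funext => u; apply/funext => v; exact: kappaE.
have khE : (fun u v => kappa_eps chi eps (sh u) (vsh v)) =
    (fun u v => bridge_cov chi eps (sh u) (vsh v)).
  by apply/funext => u; apply/funext => v; exact: kappa_epsE.
pose X := model m s n chi (fun u v => bridge_cov chi 0 (s u) (vs v)).
pose Xh := model mh sh nh chi (fun u v => bridge_cov chi eps (sh u) (vsh v)).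
have mX : measurable_fun setT X by exact: measurable_model.
have mXh : measurable_fun setT Xh by apply: measurable_model => //; exact: ltW.
have mrho : measurable_fun setT (fun z => rho_joint (Xh z) (X z)).
  under eq_fun do rewrite rho_joint_diag//.
  apply: measurable_sqrtr; apply: measurable_funD; apply: measurable_funX;
    apply: measurable_enorm; apply: measurable_submx.
  - exact: measurableT_comp (measurableT_comp measurable_snd measurable_fst) mXh.
  - exact: measurableT_comp (measurableT_comp measurable_snd measurable_fst) mX.
  - exact: measurableT_comp (measurableT_comp measurable_snd measurable_snd) mXh.
  - exact: measurableT_comp (measurableT_comp measurable_snd measurable_snd) mX.
apply: le_trans.
  apply: (W2_le_coupling (Q := noise iota jota) mXh mX _ _ mrho).
  - move=> A mA; rewrite /Mh khE; apply: kprod_model => //.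
      exact: measurable_source.
    by apply: measurable_target => //; exact: ltW.
  - move=> A mA; rewrite /M kE; apply: kprod_model => //.
      exact: measurable_source.
    exact: measurable_target.
rewrite /Dm /Dn /Ds /moment.
apply: integral_cost => //.
- exact: measurable_funX.
- by move=> z; exact: sqr_ge0.
- by apply: measurable_funX; apply: measurable_enorm; exact: measurable_submx.
- by apply: measurable_funX; apply: measurable_normF; exact: measurable_submx.
- by apply: measurable_funX; apply: measurable_enorm; exact: measurable_submx.
- by move=> u; exact: sqr_ge0.
- by move=> u; exact: sqr_ge0.
- by move=> v; exact: sqr_ge0.
- apply: filterS good => u; apply: filterS => v [+ +] g h.
  rewrite le_min ge_max => /andP[sl vl] /andP[su vu].
  rewrite rho_joint_model; apply: le_cost => //.
  + exact: lowbW sl (lowb_lambda_min d0 (pps u)).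
  + exact: lowbW vl (lowb_lambda_min d0 (ppv v)).
  + exact: opbW su (opb_opnorm _).
  + exact: opbW vu (opb_opnorm _).
Qed.

Lemma W2_le_fine : W2 rho_joint (kprod Ph Mh) (kprod P M) ^+ 2 <=
  3%:E * (Dm 2%N + Dn 2%N) +
  (48 * d%:R * Cfine Cl Cu k)%:E * (Ds 2%N + (Dv 2%N + (eps ^+ 2)%:E)).
Proof.
have -> : Dv 2%N + (eps ^+ 2)%:E =
    \int[jota]_v (normF (vsh v - vs v) ^+ 2 + eps ^+ 2)%:E.
  under eq_integral do rewrite EFinD.
  rewrite ge0_integralD//; last 3 first.
  - by move=> v _; rewrite lee_fin sqr_ge0.
  - by apply/measurable_EFinP; apply: measurable_funX;
       apply: measurable_normF; exact: measurable_submx.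
  - by move=> v _; rewrite lee_fin sqr_ge0.
  by rewrite integral_cst//= probability_setT mule1.
apply: W2_le_cost => [||u v psu pvv sl vl su vu a b g h].
- exact: Cfine_gt0.
- by move=> v; rewrite addr_ge0 ?sqr_ge0.
- apply: cost_fine => //; first exact: opnorm_ge0.
  + exact: opb_opnorm.
  + exact: ltW.
  + exact: normF_ge0.
  + exact: normF_ge0.
  + exact: opb_normF.
  + exact: opb_normF.
Qed.

Lemma W2_le_crude : W2 rho_joint (kprod Ph Mh) (kprod P M) ^+ 2 <=
  3%:E * (Dm 2%N + Dn 2%N) +
  (48 * d%:R * Ccrude Cl Cu)%:E * (Ds 2%N + (1 + bv 1%N)).
Proof.
have C0 : (0 < Ccrude Cl Cu)%R.
  by rewrite /Ccrude ltr_pwDl ?mulr_ge0// ltr_wpDl ?invr_ge0// ltW.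
have o0 v : (0 <= opnorm (vsh v))%R by exact: opnorm_ge0.
apply: (@le_trans _ _ (3%:E * (Dm 2%N + Dn 2%N) +
  (48 * d%:R * Ccrude Cl Cu)%:E * (Ds 2%N + \int[jota]_v (1 + opnorm (vsh v))%:E))).
  apply: W2_le_cost => // [v|u v psu pvv sl vl su vu a b g h].
    by rewrite addr_ge0.
  apply: cost_crude => //; first exact: ltW.
  - exact: normF_ge0.
  - exact: opb_normF.
rewrite leeD2l// lee_wpmul2l ?lee_fin ?mulr_ge0// ?(ltW C0)// leeD2l//.
rewrite /bv /moment; under [X in _ <= _ + X]eq_integral do rewrite expr1.
exact: lower_integral_add1.
Qed.

(** [Cl <= |sigma_u| <= |hat sigma_u| + |hat sigma_u - sigma_u|]. *)
Lemma small_estimate_Ds : bs 1%N <= (Cl / 2)%:E -> (Cl ^+ 2 / 4)%:E <= Ds 2%N.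
Proof.
apply: moment2_lower_bound => //.
- by apply: measurable_normF; exact: measurable_submx.
- by move=> u; exact: normF_ge0.
- by move=> u; exact: opnorm_ge0.
apply: filterS good => u gu.
(* The bound on [s u] is only known together with one on [vs v], almost
   everywhere in [v]; one such [v] is enough. *)
have [v [+ _]] : exists v, (Cl <= Num.min (lambda_min (s u)) (lambda_min (vs v)))%R /\
  (Num.max (opnorm (s u)) (opnorm (vs v)) <= Cu)%R.
  apply: contrapT => /forallNP nex; have [N [mN N0 subN]] := gu.
  have : jota [set: borel V] <= jota N.
    by apply: le_measure; rewrite ?inE//; apply: subset_trans subN => v _ /=; exact: nex.
  by rewrite N0 probability_setT lee_fin ler10.
rewrite le_min => /andP[sl _].
have su := opbD (opb_opnorm (sh u)) (opbN (opb_normF (sh u - s u)%R)).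
rewrite opprB addrCA subrr addr0 in su.
exact: lowb_le_opb d0 (lowbW sl (lowb_lambda_min d0 (spd_psd (ps u)))) su.
Qed.

(** The coefficients of [Dm], [Dn], of the fine case (with [1 <= 2 / Cl B]) and of
    the crude case (with [1 + bv 1 <= (1 + Cl / 2) (4 / Cl^2) Ds 2]). *)
Definition Ctotal (Cl Cu k : R) : R :=
  (3 + 48 * Cfine Cl Cu k * (1 + 2 / Cl)
     + 48 * Ccrude Cl Cu * (1 + (1 + Cl / 2) * (4 / Cl ^+ 2)))%R.


(** The fine bound when [B] is at least [Cl / 2], the crude one otherwise. *)
Lemma W2_le_total : W2 rho_joint (kprod Ph Mh) (kprod P M) ^+ 2 <=
  (Ctotal Cl Cu k * d%:R)%:E * (Dm 2%N + Dn 2%N + Ds 2%N +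
    Bmax bs bv * (Dv 2%N + Dv 4%N `^ 2^-1 +
      (eps ^- 2)%:E * (Ds 2%N + Ds 4%N `^ 2^-1 + Dv 4%N `^ 2^-1) + (eps ^+ 2)%:E)).
Proof.
have C1 := ltW Cfine_gt0; have C2 : (0 <= Ccrude Cl Cu)%R.
  rewrite /Ccrude; have : (0 <= Cl^-1)%R by rewrite invr_ge0 ltW.
  by move: Cu0; lra.
have d1 : (1 <= d%:R :> R)%R by rewrite ler1n.
have q0 : (0 <= (1 + Cl / 2) * (4 / Cl ^+ 2))%R.
  by rewrite mulr_ge0 ?addr_ge0 ?divr_ge0 ?sqr_ge0// ltW.
have f1 : (0 <= 48 * Cfine Cl Cu k * (2 / Cl))%R.
  by rewrite !mulr_ge0// invr_ge0 ltW.
have g1 : (0 <= 48 * Ccrude Cl Cu * ((1 + Cl / 2) * (4 / Cl ^+ 2)))%R.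
  by apply: mulr_ge0 q0; exact: mulr_ge0.
have T3 : (3 <= Ctotal Cl Cu k * d%:R)%R.
  rewrite -[leLHS]mulr1 ler_pM// /Ctotal; move: C1 C2 f1 g1; lra.
have T1 : (48 * d%:R * Cfine Cl Cu k <= Ctotal Cl Cu k * d%:R)%R.
  rewrite mulrAC ler_wpM2r// /Ctotal; move: C1 C2 f1 g1; lra.
have T2 : (48 * d%:R * Cfine Cl Cu k <= Ctotal Cl Cu k * d%:R * (Cl / 2))%R.
  rewrite mulrAC [leRHS]mulrAC ler_wpM2r// -ler_pdivrMr ?divr_gt0//.
  by rewrite invf_div /Ctotal; move: C1 C2 f1 g1; lra.
have T4 : (48 * d%:R * Ccrude Cl Cu * (1 + (1 + Cl / 2) * (4 / Cl ^+ 2)) <=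
    Ctotal Cl Cu k * d%:R)%R.
  rewrite mulrAC (mulrAC 48%R) mulrAC ler_wpM2r// /Ctotal; move: C1 C2 f1 g1; lra.
have := small_estimate_Ds; have := W2_le_crude; have := W2_le_fine.
have := le_Bmax_s bs bv; have := le_Bmax_v bs bv.
have := moment_ge0 iota 2 (fun u => enorm_ge0 (mh u - m u)%R); rewrite -/Dm.
have := moment_ge0 jota 2 (fun v => enorm_ge0 (nh v - n v)%R); rewrite -/Dn.
have := moment_ge0 iota 2 (fun u => normF_ge0 (sh u - s u)%R); rewrite -/Ds.
have := moment_ge0 jota 2 (fun v => normF_ge0 (vsh v - vs v)%R); rewrite -/Dv.
have := moment_ge0 iota 1 (fun u => opnorm_ge0 (sh u)); rewrite -/bs.
have S0 : 0 <= Dv 4%N `^ 2^-1 +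
    (eps ^- 2)%:E * (Ds 2%N + Ds 4%N `^ 2^-1 + Dv 4%N `^ 2^-1).
  have Ds0 : 0 <= Ds 2%N := moment_ge0 iota 2 (fun u => normF_ge0 (sh u - s u)%R).
  apply: adde_ge0; first exact: poweR_ge0.
  apply: mule_ge0; first by rewrite lee_fin invr_ge0 sqr_ge0.
  apply: adde_ge0; last exact: poweR_ge0.
  by apply: adde_ge0 => //; exact: poweR_ge0.
move: S0; rewrite -[Dv 2%N + _ + _]addeA.
move: (Dv 4%N `^ _ + _) => S S0.
move: (W2 _ _ _ ^+ 2) (Bmax _ _) (Dm 2%N) (Dn 2%N) (Ds 2%N) (Dv 2%N) (bs 1%N) (bv 1%N).
move=> W B xm xn y z t r t0 z0 y0 xn0 xm0 rB tB Wf Wc ty.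
have B0 : 0 <= B by exact: le_trans tB.
have T0 : (0 <= Ctotal Cl Cu k * d%:R)%R by exact: le_trans T3.
move: (Ctotal Cl Cu k * d%:R)%R T0 T1 T2 T3 T4 => T T0 T1 T2 T3 T4.
have x0 : 0 <= xm + xn by rewrite adde_ge0.
have e2 : 0 <= (eps ^+ 2)%:E by rewrite lee_fin sqr_ge0.
have BS0 : 0 <= B * (z + S + (eps ^+ 2)%:E) by rewrite mule_ge0// !adde_ge0.
rewrite ge0_muleDr ?adde_ge0// (ge0_muleDr T%:E)//.
have [Bl|Bl] := leP (Cl / 2)%:E B.
- apply: (le_trans Wf); rewrite -addeA; apply: leeD.
    by rewrite lee_wpmul2r// lee_fin.
  rewrite ge0_muleDr ?adde_ge0//; apply: leeD.
    by rewrite lee_wpmul2r// lee_fin.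
  apply: (@le_trans _ _ ((T * (Cl / 2))%:E * (z + (eps ^+ 2)%:E))).
    by rewrite lee_wpmul2r ?adde_ge0// lee_fin.
  rewrite EFinM -muleA lee_wpmul2l ?lee_fin//.
  apply: lee_pmul => //; rewrite ?adde_ge0// ?lee_fin ?divr_ge0 ?(ltW Cl0)//.
  by rewrite leeD2r// leeDl.
- have {}ty := ty (le_trans tB (ltW Bl)).
  apply: (le_trans Wc); apply: (@le_trans _ _ (T%:E * (xm + xn) + T%:E * y)); last first.
    by rewrite leeDl// mule_ge0.
  apply: leeD; first by rewrite lee_wpmul2r// lee_fin.
  apply: (@le_trans _ _ ((48 * d%:R * Ccrude Cl Cu *
      (1 + (1 + Cl / 2) * (4 / Cl ^+ 2)))%:E * y)); last first.
    by rewrite lee_wpmul2r// lee_fin.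
  rewrite [X in _ <= X * _]EFinM -muleA lee_wpmul2l ?lee_fin ?mulr_ge0//.
  rewrite EFinD ge0_muleDl ?lee_fin// mul1e leeD2l//.
  apply: (@le_trans _ _ (1 + Cl / 2)%:E).
    by rewrite EFinD leeD2l// (le_trans rB)// ltW.
  rewrite [X in _ <= X * _]EFinM -muleA -[leLHS]mule1 lee_wpmul2l//.
    by rewrite lee_fin addr_ge0// divr_ge0// ltW.
  have c4 : (0 <= 4 / Cl ^+ 2)%R by rewrite divr_ge0// sqr_ge0.
  apply: (@le_trans _ _ ((4 / Cl ^+ 2)%:E * (Cl ^+ 2 / 4)%:E)).
    rewrite -EFinM lee_fin -[X in (_ <= X * _)%R]invf_div mulVf//.
    by rewrite gt_eqF// divr_gt0// exprn_gt0.
  by rewrite lee_wpmul2l// lee_fin.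
Qed.

End assembly.

Theorem theorem5p6 (R : realType) :
  exists C : R -> R -> R -> R -> R -> R,
  forall (d : nat) (U V : pmetricType R)
    (iota : probability (borel U) R) (jota : probability (borel V) R)
    (m mh : borel U -> 'cV[R]_d) (sigma sigmah : borel U -> 'M[R]_d)
    (n nh : borel V -> 'cV[R]_d) (vsigma vsigmah : borel V -> 'M[R]_d)
    (beta tau : 'M[R]_d) (eps a Cl Cu : R),
  let chi := invmx tau *m beta in
  let P := marginal iota m sigma in
  let Ph := marginal iota mh sigmah in
  let M := transition jota chi m n
             (fun u v => kappa chi (sigma u) (vsigma v)) in
  let Mh := transition jota chi mh nh
             (fun u v => kappa_eps chi eps (sigmah u) (vsigmah v)) in
  let Dm := moment iota (fun u => enorm (mh u - m u)) in
  let Dn := moment jota (fun v => enorm (nh v - n v)) in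
  let Ds := moment iota (fun u => normF (sigmah u - sigma u)) in
  let Dv := moment jota (fun v => normF (vsigmah v - vsigma v)) in
  let B := Bmax (moment iota (fun u => opnorm (sigmah u)))
                (moment jota (fun v => opnorm (vsigmah v))) in
  (0 < d)%N ->
  measurable_fun setT m -> measurable_fun setT mh ->
  measurable_fun setT sigma -> measurable_fun setT sigmah ->
  measurable_fun setT n -> measurable_fun setT nh ->
  measurable_fun setT vsigma -> measurable_fun setT vsigmah ->
  spd tau ->
  (forall u, spd (sigma u)) -> (forall u, psd (sigmah u)) ->
  (forall v, spd (vsigma v)) -> (forall v, psd (vsigmah v)) ->
  0 < eps ->
  0 <= a ->
  (forall x y, (W2 rho_aug (M x) (M y) <= (a * rho_aug x y)%:E)%E) ->
  0 < Cl -> Cl <= Cu ->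
  {ae iota, forall u, {ae jota, forall v,
     Cl <= Num.min (lambda_min (sigma u)) (lambda_min (vsigma v)) /\
     Num.max (opnorm (sigma u)) (opnorm (vsigma v)) <= Cu}} ->
  spd (chi *m chi^T) ->
  (W2 rho_joint (kprod Ph Mh) (kprod P M) ^+ 2 <=
   (C a Cl Cu (opnorm chi) (lambda_min (chi *m chi^T)) * d%:R)%:E *
   (Dm 2%N + Dn 2%N + Ds 2%N +
    B * (Dv 2%N + Dv 4%N `^ 2^-1 +
         (eps ^- 2)%:E * (Ds 2%N + Ds 4%N `^ 2^-1 + Dv 4%N `^ 2^-1) +
         (eps ^+ 2)%:E)))%E.
Proof.
exists (fun _ Cl Cu k _ => Ctotal Cl Cu k).
move=> d U V iota jota m mh s sh n nh vs vsh beta tau eps a Cl Cu chi P Ph M Mh.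
move=> Dm Dn Ds Dv B d0 mm mmh ms msh mn mnh mv mvh _ ps psh pv pvh eps0 _ _.
by move=> Cl0 ClCu good spd_chi; exact: W2_le_total.
Qed.
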